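(* Let $\ell\ge0$ be an integer and $Z>0$. For $h,R>0$ let $E_{\ell+1}(R)<E_{\ell+2}(R)<\cdots<0$ be the negative eigenvalues of the confined Coulomb operator $H_R(\ell;h)$. Fix an integer $n\ge\ell+1$. Then for $R^{-1}h^2$ sufficiently small depending on $n$, $$E_n(R)=-\frac{Z^2}{4n^2h^2}+\frac{2^{2n+1}\,h^{-4n-2}\,R^{2n}}{n^{2n+3}\,(n-\ell-1)!\,(n+\ell)!}\left(\frac{2}{Z}\right)^{-2n-2}e^{-ZR/(nh^2)}\left(1+\mathcal{O}(h^2R^{-1})\right).$$
   Context: $D_y=-i\,d/dy$. $H_R(\ell;h)$ is the self-adjoint operator on $L^2((0,R))$ with action $$h^2D_y^2+\frac{h^2\ell(\ell+1)}{y^2}-\frac{Z}{y},$$ with a Dirichlet boundary condition at $y=R$ and, when $\ell=0$, a Dirichlet boundary condition at $y=0$ (for $\ell>0$ no boundary condition is needed at $0$). It is bounded below and has discrete spectrum in $(-\infty,0)$; its negative eigenvalues are labelled in increasing order starting with the index $\ell+1$. (The corresponding unconfined operator on $L^2((0,\infty))$ has negative eigenvalues $E_n=-Z^2/(4n^2h^2)$, $n\ge\ell+1$.) The implied constant in $\mathcal{O}(h^2R^{-1})$ does not depend on $R$ or $h$. *)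

(* Defs.v *)
From HB Require Import structures.
From mathcomp Require Import all_boot all_order all_algebra.
From mathcomp Require Import complex.
From mathcomp Require Import all_classical all_reals all_analysis.
Set Implicit Arguments.
Unset Strict Implicit.
Unset Printing Implicit Defensive.
Import Order.TTheory GRing.Theory Num.Theory.
Import numFieldNormedType.Exports.
Local Open Scope classical_set_scope.
Local Open Scope ring_scope.
Local Open Scope complex_scope.
Local Open Scope card_scope.

(* Unbounded operators on the complex space L^2((0, b)) are given by their
   graphs, on representatives: functions R -> R[i], of which only the values on
   ]0, b[ matter up to null sets, except that the elements of the domain are
   represented by their continuous version on ]0, b]. *)

(* L^2((0, b)), as the functions whose extension by zero is in L^2(R). *)
Definition L2_fun (R : realType) (b : R) (u : R -> R[i]) : Prop :=
  ((fun y => complex.Re (u y)) \_ `]0, b[ : R -> R) \in Lfun lebesgue_measure 2%:E /\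
  ((fun y => complex.Im (u y)) \_ `]0, b[ : R -> R) \in Lfun lebesgue_measure 2%:E.

(* f is locally absolutely continuous on ]0, b], with a.e. derivative g;
   nothing is required of g near 0. *)
Definition ac_deriv (R : realType) (b : R) (f g : R -> R) : Prop :=
  forall y : R, 0 < y <= b ->
    lebesgue_measure.-integrable `[y, b] (EFin \o g) /\
    f b - f y = \int[lebesgue_measure]_(t in `[y, b]) g t.

Definition ac_derivC (R : realType) (b : R) (f g : R -> R[i]) : Prop :=
  ac_deriv b (fun y => complex.Re (f y)) (fun y => complex.Re (g y)) /\
  ac_deriv b (fun y => complex.Im (f y)) (fun y => complex.Im (g y)).

(* w = D_y f with D_y = - i d/dy *)
Definition is_Dy (R : realType) (b : R) (f w : R -> R[i]) : Prop :=
  exists g : R -> R[i],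
    ac_derivC b f g /\ forall y : R, w y = - 'i%C * g y.

(* The graph of H_b(l; h) = h^2 D_y^2 + h^2 l (l + 1) / y^2 - Z / y: the maximal
   domain with u(b) = 0, and u(0+) = 0 when l = 0. This realization is
   self-adjoint: the expression is in the limit-point case at 0 iff l > 0. *)
Definition coulomb_graph (R : realType) (l : nat) (Z h b : R)
    (u v : R -> R[i]) : Prop :=
  [/\ L2_fun b u,
      L2_fun b v,
      u b = 0,
      l = 0%N -> ((complex.Re (u y) @[y --> 0^'+] --> (0 : R)) /\
                  (complex.Im (u y) @[y --> 0^'+] --> (0 : R)))
    & exists u1 u2 : R -> R[i],
      [/\ is_Dy b u u1,
          is_Dy b u1 u2
        & {ae lebesgue_measure, forall y : R, 0 < y < b ->
            v y = (h ^+ 2)%:C * u2 y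
                  + (h ^+ 2 * (l * l.+1)%:R / y ^+ 2)%:C * u y
                  - (Z / y)%:C * u y}]].

(* The operator is self-adjoint, so only real eigenvalues need considering. *)
Definition coulomb_eigenvalue (R : realType) (l : nat) (Z h b E : R) : Prop :=
  exists u : R -> R[i],
    coulomb_graph l Z h b u (fun y => E%:C * u y) /\
    ~ {ae lebesgue_measure, forall y : R, 0 < y < b -> u y = 0}.

(* E = E_n(b): the negative eigenvalues are labelled increasingly from l + 1,
   so exactly n - (l + 1) of them lie below E_n(b). *)
Definition coulomb_nth_eigenvalue (R : realType) (l : nat) (Z h b : R)
    (n : nat) (E : R) : Prop :=
  [/\ (l < n)%N,
      E < 0,
      coulomb_eigenvalue l Z h b E
    & [set E' : R | coulomb_eigenvalue l Z h b E' /\ E' < E]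
        #= `I_(n - l.+1)%N].

(* Main.v *)
Require Import Defs.
From mathcomp Require Import all_boot all_order all_algebra.
From mathcomp Require Import complex.
From mathcomp Require Import all_classical all_reals all_analysis.
From mathcomp Require Import measurable_realfun.
From mathcomp Require Import ring lra zify.
Import Order.TTheory GRing.Theory Num.Theory.
Import numFieldNormedType.Exports.
Local Open Scope classical_set_scope.
Local Open Scope ring_scope.

Set Implicit Arguments.
Unset Strict Implicit.
Unset Printing Implicit Defensive.


(** In the variable x = Z y / h^2, and with the energy written as
    E = - Z^2 s^2 / (4 h^2), s > 0, the eigenvalue equation becomes Whittaker's
    equation u'' = (l (l+1) / x^2 - 1 / x + s^2 / 4) u.  Its solution regular at
    0 is x^(l+1) exp(- s x / 2) F(s, x), where F(s, x) = M(l+1-1/s, 2l+2, s x) is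
    Kummer's function ([kummer], [kummer_ode]).  Any solution that is not a
    multiple of it has a nonzero Wronskian with it, hence is at least of size
    x^(-l) near 0 ([singular_growth]): it is not square integrable if l > 0 and
    does not tend to 0 if l = 0.  So E is an eigenvalue if and only if
    F(s, Z b / h^2) = 0 ([eigenvalue_kummer0], [kummer0_eigenvalue]); the
    unconfined levels E_m are the points s = 1/m.

    The zeros of F(., x) for a fixed large x are found as follows.  Up to a
    positive constant the k-th coefficient of F(s, .) is
    prod_(j<k) ((l+1+j) s - 1).  These are nonnegative for s >= 1/(l+1), where F
    is therefore positive ([kummer_gt0]).  Near s = 1/m, m = l+1+N, the small
    factor m s - 1 (j = N) is common to all terms of degree > N
    ([kummer_split]); after division by prod_(j<N) ((l+1+j) s - 1), which does
    not vanish, F(s, x) = 0 reads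
        H(s) = (1 - m s) T(s),
    with H(s) = c x^N (1 + O(1/x)), c > 0, of Lipschitz constant O(x^N)
    ([head_rest_bound]), and T positive, increasing, of relative Lipschitz
    constant O(x) ([kummer_tail_lip]) and at least of order x^(N+3).  Such an
    equation has exactly one root in the window
    2/(2m+1) <= s <= 2/(2m-1), with 1 - m s = H(s) / T(1/m) (1 + O(1/x))
    ([perturbed_zero]).  At s = 1/m the series T is a multiple of
    sum_i r^i i! / ((i+A)! (i+B)!) with r = x/m, and the quotient of
    i! / ((i+A)! (i+B)!) by 1 / (i+A+B)! is 1 + O(1/i), so the sum is
    r^(-A-B) e^r (1 + O(1/r)) ([fact2_sum_asymp]).  This gives the exponentially
    small shift 1 - m s ([kummer_zero]).

    The windows for m = l+1, ..., n cover all s between 2/(2n+1) and 1/(l+1),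
    each contains one zero, and s decreases with m.  Hence exactly n-l-1
    eigenvalues lie below the one near s = 1/n ([lower_levels]), which is thus
    E_n, and expanding - Z^2 s^2 / (4 h^2) at s = 1/n gives the formula
    ([energy_expansion]). *)

(** * Entire power series and Kummer's equation *)

(** A coefficient bound that gives an entire series and that is inherited by
    the derived series. *)
Definition exp_dominated (R : realType) (c : nat -> R) :=
  exists B D : R, 0 <= D /\ forall k, `|c k| <= B * (D ^+ k / k`!%:R).

Lemma exp_dominated_cvg (R : realType) (c : nat -> R) (x : R) :
  exp_dominated c -> cvgn (pseries c x).
Proof.
move=> [B [D [D0 cB]]]; apply: normed_cvg.
have B0 : 0 <= B.
  by have := cB 0%N; rewrite expr0 fact0 divr1 mulr1; apply: le_trans.
apply: (@series_le_cvg _ _ (B *: (exp_coeff (D * `|x|)))) => //.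
- by move=> n /=.
- by move=> n; rewrite /GRing.scale /= mulr_ge0 // exp_coeff_ge0 // mulr_ge0.
- move=> n /=; rewrite normrM normrX.
  rewrite (le_trans (ler_wpM2r _ (cB n))) ?exprn_ge0 //.
  rewrite /GRing.scale /= /exp_coeff /= exprMn -mulrA ler_wpM2l //.
  by rewrite mulrAC.
- exact/is_cvg_seriesZ/is_cvg_series_exp_coeff.
Qed.

Lemma exp_dominated_diffs (R : realType) (c : nat -> R) :
  exp_dominated c -> exp_dominated (pseries_diffs c).
Proof.
move=> [B [D [D0 cB]]]; exists (B * D), D; split => // k.
rewrite /pseries_diffs normrM ger0_norm // (le_trans (ler_wpM2l _ (cB _))) //.
rewrite factS natrM exprS [leLHS](_ : _ = B * D * (D ^+ k / k`!%:R)) //.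
field.
by rewrite nat1r !pnatr_eq0 -lt0n fact_gt0.
Qed.

Lemma exp_dominated_derive (R : realType) (c : nat -> R) (x : R) :
  exp_dominated c ->
  is_derive x 1 (fun x => limn (pseries c x)) (limn (pseries (pseries_diffs c) x)).
Proof.
move=> cB.
have cB1 := exp_dominated_diffs cB; have cB2 := exp_dominated_diffs cB1.
apply: (@pseries_snd_diffs _ c (`|x| + 1)); try exact: exp_dominated_cvg.
by rewrite (@ger0_norm _ (_ + _)) ?ltrDl ?addr_ge0.
Qed.

(** Multiplying the derived series by the variable turns Kummer's equation into
    a recurrence between coefficients. *)
Lemma cvg_pseries_mul_diffs (R : realType) (c : nat -> R) (x : R) :
  exp_dominated c ->
  pseries (fun k => k%:R * c k) x @ \oo --> x * limn (pseries (pseries_diffs c) x).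
Proof.
move=> cB.
have /cvgMl_tmp := @exp_dominated_cvg _ _ x (exp_dominated_diffs cB).
move=> /(_ x) H; rewrite -(cvg_shiftS _).
apply: cvg_trans H; apply: near_eq_cvg; near=> n.
rewrite /pseries /series /= big_nat_recl // mul0r mul0r add0r mulr_sumr.
by apply: eq_bigr => i _; rewrite /pseries_diffs exprS; ring.
Unshelve. all: by end_near. Qed.

Section kummer.
Variables (R : realType) (l : nat).
Implicit Types (s x : R).

(** The quotient of factorials is 1 / ((2l+2)_k k!), and the product is
    s^k (l+1-1/s)_k: these are the coefficients of x |-> M(l+1-1/s, 2l+2, s x),
    with the parameter s placed so that each factor is affine and increasing
    in s. *)
Definition kummer_coef s k : R :=
  (\prod_(j < k) ((l + 1 + j)%:R * s - 1))
  * ((2 * l + 1)`!%:R / ((2 * l + 1 + k)`!%:R * k`!%:R)).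

Lemma kummer_coefS s k :
  k.+1%:R * (2 * l + 2 + k)%:R * kummer_coef s k.+1
  = ((l + 1 + k)%:R * s - 1) * kummer_coef s k.
Proof.
rewrite /kummer_coef big_ord_recr /= [(_ + k.+1)%N]addnS (factS (2 * l + 1 + k)) (factS k) !natrM.
rewrite (_ : (2 * l + 2 + k) = (2 * l + 1 + k).+1)%N; last by rewrite addn2 addn1 addSn.
have F n : n`!%:R != 0 :> R by rewrite pnatr_eq0 -lt0n fact_gt0.
have S n : n.+1%:R != 0 :> R by rewrite pnatr_eq0.
move: (F (2 * l + 1 + k)%N) (F k) (S (2 * l + 1 + k)%N) (S k).
move: (_ `!)%:R (_ `!)%:R (_.+1)%:R (_.+1)%:R => a b c d a0 b0 c0 d0.
by field; rewrite a0 b0 c0 d0.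
Qed.

Lemma kummer_coef_dominated s : 0 <= s -> exp_dominated (kummer_coef s).
Proof.
move=> s0; exists 1, (s + 1); split=> [|k]; first by rewrite addr_ge0.
rewrite mul1r; elim: k => [|k IH].
  by rewrite /kummer_coef big_ord0 expr0 fact0 addn0 mul1r mulr1 divff ?divr1
    ?normr1 // pnatr_eq0 -lt0n fact_gt0.
have k0 : 0 < k.+1%:R :> R by rewrite ltr0n.
have k1 : 0 < (2 * l + 2 + k)%:R :> R by rewrite ltr0n; lia.
have -> : kummer_coef s k.+1 = ((l + 1 + k)%:R * s - 1) / (2 * l + 2 + k)%:R
    * kummer_coef s k / k.+1%:R.
  have := kummer_coefS s k.
  rewrite -[_ * _ * kummer_coef s k.+1]mulrC => /(canRL (mulfK _)) ->.
    by field; rewrite !gt_eqF // nat1r.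
  by rewrite mulf_neq0 // gt_eqF.
move: (kummer_coef s k) IH => a IH.
rewrite exprS factS natrM invfM !normrM (ger0_norm (_ : 0 <= k.+1%:R^-1)) //.
rewrite [leRHS](_ : _ = (s + 1) * ((s + 1) ^+ k / k`!%:R) / k.+1%:R); last by ring.
rewrite ler_wpM2r // ler_pM //.
rewrite normfV (gtr0_norm k1) ler_pdivrMr //.
rewrite (le_trans (ler_normB _ _)) // normr1 normrM !ger0_norm // mulrDl mul1r.
rewrite lerD ?ler1n //; last by lia.
by rewrite mulrC ler_wpM2l // ler_nat; lia.
Qed.

Definition kummer s x : R := limn (pseries (kummer_coef s) x).
Definition kummer1 s x : R := limn (pseries (pseries_diffs (kummer_coef s)) x).
Definition kummer2 s x : R :=
  limn (pseries (pseries_diffs (pseries_diffs (kummer_coef s))) x).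

Lemma is_derive_kummer s x : 0 <= s -> is_derive x 1 (kummer s) (kummer1 s x).
Proof. by move=> s0; exact/exp_dominated_derive/kummer_coef_dominated. Qed.

Lemma is_derive_kummer1 s x : 0 <= s -> is_derive x 1 (kummer1 s) (kummer2 s x).
Proof.
by move=> s0; exact/exp_dominated_derive/exp_dominated_diffs/kummer_coef_dominated.
Qed.

Lemma kummer0 s : kummer s 0 = 1.
Proof.
rewrite /kummer; apply/cvg_lim => //; rewrite -(cvg_shiftS _).
apply: (@cvg_trans _ (cst 1 @ \oo)%classic); last exact: cvg_cst.
apply: near_eq_cvg; near=> n.
rewrite /pseries /series /= big_nat_recl // big1 => [|i _]; last first.
  by rewrite exprS mul0r mulr0.
rewrite /kummer_coef big_ord0 expr0 addn0 !mulr1 mul1r addr0 divff //.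
Unshelve. all: by end_near. Qed.

(** Kummer's equation in the variable x; the coefficient of x^k is
    [kummer_coefS]. *)
Lemma kummer_ode s x : 0 <= s ->
  x * kummer2 s x + ((2 * l + 2)%:R - s * x) * kummer1 s x
    + (1 - (l + 1)%:R * s) * kummer s x = 0.
Proof.
move=> s0.
have cB := kummer_coef_dominated s0; have cB1 := exp_dominated_diffs cB.
have h2 := @cvg_pseries_mul_diffs _ _ x cB1.
have h1 := @cvg_pseries_mul_diffs _ _ x cB.
have c1 := @exp_dominated_cvg _ _ x cB1; have c0 := @exp_dominated_cvg _ _ x cB.
rewrite [LHS](_ : _ = x * kummer2 s x + (2 * l + 2)%:R * kummer1 s x
  + - s * (x * kummer1 s x) + (1 - (l + 1)%:R * s) * kummer s x); last by ring.
apply: (@cvg_unique _ (@Rhausdorff R) (cst 0 n @[n --> \oo])); last exact: cvg_cst.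
rewrite (_ : cst 0 = fun n =>
  pseries (fun k => k%:R * pseries_diffs (kummer_coef s) k) x n
  + (2 * l + 2)%:R * pseries (pseries_diffs (kummer_coef s)) x n
  + - s * pseries (fun k => k%:R * kummer_coef s k) x n
  + (1 - (l + 1)%:R * s) * pseries (kummer_coef s) x n).
  by apply: cvgD; [apply: cvgD; [apply: cvgD|]|] => //; apply: cvgMl_tmp.
apply/funext => n; rewrite /pseries /series /= !mulr_sumr -!big_split /=.
apply/esym/big1 => k _; rewrite /pseries_diffs.
rewrite [LHS](_ : _ = x ^+ k * (k.+1%:R * (2 * l + 2 + k)%:R * kummer_coef s k.+1
  - ((l + 1 + k)%:R * s - 1) * kummer_coef s k)).
  by rewrite kummer_coefS subrr mulr0.
by rewrite !natrD -nat1r; ring.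
Qed.

End kummer.

(** * Factorial sums compared with the exponential series *)

Lemma series_split (R : realType) (u : nat -> R) (n : nat) :
  cvgn (series u) ->
  cvgn (series (fun i => u (n + i)%N)) /\
  limn (series u) = \sum_(k < n) u k + limn (series (fun i => u (n + i)%N)).
Proof.
move=> cu.
have E : series (fun i => u (n + i)%N)
    = (fun k => series u (k + n)%N - \sum_(k < n) u k).
  apply/funext => k; rewrite addnC /series /= -(big_mkord xpredT) /=.
  rewrite (big_cat_nat (leq0n n) (leq_addr k n)) /= [RHS]addrAC subrr add0r.
  by rewrite -{2}[n]add0n big_addn addKn; apply: eq_bigr => i _; rewrite addnC.
have H : series (fun i => u (n + i)%N) @ \oo --> limn (series u) - \sum_(k < n) u k.
  by rewrite E; apply: cvgB; [rewrite (cvg_shiftn n)|exact: cvg_cst].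
by split; [apply/cvg_ex; exists (limn (series u) - \sum_(k < n) u k)|
  rewrite (cvg_lim _ H) // addrC subrK].
Qed.

Lemma lim_series_ge0 (R : realType) (u : nat -> R) :
  cvgn (series u) -> (forall i, 0 <= u i) -> 0 <= limn (series u).
Proof.
move=> cu u0; apply: limr_ge => //; near=> n.
by rewrite /series /= sumr_ge0.
Unshelve. all: by end_near. Qed.

Lemma lim_series_ge_term (R : realType) (u : nat -> R) (n : nat) :
  cvgn (series u) -> (forall i, 0 <= u i) -> u n <= limn (series u).
Proof.
move=> cu u0; have [cs ->] := series_split n.+1 cu.
rewrite big_ord_recr /= -addrA [leRHS]addrCA lerDl addr_ge0 ?sumr_ge0 //.
exact: lim_series_ge0.
Qed.

Lemma expR_ge_term (R : realType) (x : R) (n : nat) :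
  0 <= x -> x ^+ n / n`!%:R <= expR x.
Proof.
move=> x0; apply: (@lim_series_ge_term _ (exp_coeff x) n) => [|i].
  exact: is_cvg_series_exp_coeff.
exact: exp_coeff_ge0.
Qed.

Lemma exp_tail (R : realType) (x : R) (M : nat) : 0 < x ->
  cvgn (series (fun i => x ^+ i / (i + M)`!%:R)) /\
  x ^+ M * limn (series (fun i => x ^+ i / (i + M)`!%:R))
    = expR x - \sum_(k < M) x ^+ k / k`!%:R.
Proof.
move=> x0; have [cs E] := series_split M (is_cvg_series_exp_coeff x).
have F : (fun i => exp_coeff x (M + i)%N)
    = x ^+ M *: (fun i => x ^+ i / (i + M)`!%:R).
  by apply/funext => i; rewrite /exp_coeff /= exprD addnC -mulrA.
have G : (fun i => x ^+ i / (i + M)`!%:R)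
    = (x ^+ M)^-1 *: (fun i => exp_coeff x (M + i)%N).
  by rewrite F scalerA mulVf ?scale1r // gt_eqF // exprn_gt0.
split; first by rewrite G; exact: is_cvg_seriesZ.
rewrite /expR E addrC addKr G lim_seriesZ //.
by rewrite /GRing.scale /= mulrA divff ?mul1r // gt_eqF // exprn_gt0.
Qed.

Lemma exp_tail_le (R : realType) (x : R) (M : nat) : 0 < x ->
  x ^+ M * limn (series (fun i => x ^+ i / (i + M)`!%:R)) <= expR x.
Proof.
move=> x0; have [_ ->] := exp_tail M x0; rewrite gerBl sumr_ge0 // => i _.
by rewrite divr_ge0 // exprn_ge0 // ltW.
Qed.

(** Each of the M removed terms is at most exp(x) M / x, because
    x^(k+1) / (k+1)! is at most exp(x). *)
Lemma exp_tail_ge (R : realType) (x : R) (M : nat) : 0 < x ->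
  expR x * (1 - (M * M)%:R / x)
    <= x ^+ M * limn (series (fun i => x ^+ i / (i + M)`!%:R)).
Proof.
move=> x0; have [_ ->] := exp_tail M x0.
rewrite mulrBr mulr1 lerD2l lerN2.
apply: (@le_trans _ _ (\sum_(k < M) (expR x * (M%:R / x)))); last first.
  by rewrite sumr_const card_ord -[leLHS]mulr_natr natrM -!mulrA [x^-1 * _]mulrC.
apply: ler_sum => k _.
rewrite mulrA ler_pdivlMr //.
apply: (@le_trans _ _ (k.+1%:R * (x ^+ k.+1 / k.+1`!%:R))).
  rewrite factS natrM exprS invfM le_eqVlt; apply/orP; left; apply/eqP.
  have : k`!%:R != 0 :> R by rewrite pnatr_eq0 -lt0n fact_gt0.
  by move: (k`!%:R) => a a0; field; rewrite a0 nat1r pnatr_eq0.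
by rewrite mulrC ler_pM ?expR_ge_term ?divr_ge0 ?exprn_ge0 ?ler_nat // ltW.
Qed.

(** The quotient q of the two sides' leading terms,
    q_A = i! (i+A+B)! / ((i+A)! (i+B)!), satisfies
    q_(A+1) = q_A (1 + B / (i+A+1)), whence q_A <= 1 + K / (i+1) by induction on
    A.  The error is written with (i+A+B+1)! so that it sums to a shifted
    exponential series. *)
Lemma fact_ratio_le (R : realType) (A B : nat) :
  exists2 K : R, 0 <= K & forall i : nat,
    i`!%:R / ((i + A)`!%:R * (i + B)`!%:R)
    <= ((i + (A + B))`!%:R)^-1 + K / (i + (A + B).+1)`!%:R.
Proof.
have F n : 0 < n`!%:R :> R by rewrite ltr0n fact_gt0.
suff [K K0 H] : exists2 K : R, 0 <= K & forall i : nat,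
    i`!%:R * (i + (A + B))`!%:R
    <= (i + A)`!%:R * (i + B)`!%:R * (1 + K / i.+1%:R).
  (* 1 / (i+1) <= (A+B+1) / (i+A+B+1) *)
  exists (K * (A + B).+1%:R) => [|i]; first by rewrite mulr_ge0.
  rewrite ler_pdivrMr ?mulr_gt0 // -(ler_pM2r (F (i + (A + B))%N)).
  apply: (le_trans (H i)); rewrite [leRHS]mulrAC [leRHS]mulrC.
  apply: ler_wpM2l; first by rewrite mulr_ge0 // ltW.
  rewrite mulrDl mulVf ?gt_eqF // lerD2l.
  rewrite addnS factS natrM invfM -!mulrA mulVf ?gt_eqF // mulr1.
  rewrite ler_wpM2l // ler_pdivlMr // mulrC ler_pdivrMr // -natrM ler_nat.
  by nia.
elim: A => [|A [K K0 H]].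
  by exists 0 => // i; rewrite mul0r addr0 mulr1 addn0 add0n.
exists (K + B%:R + K * B%:R) => [|i]; first by rewrite !addr_ge0 // mulr_ge0.
have w0 : 0 < i.+1%:R^-1 :> R by rewrite invr_gt0.
have w1 : i.+1%:R^-1 <= 1 :> R by rewrite invf_le1 ?ler1n.
have step : (i + (A + B)).+1%:R <= (i + A).+1%:R * (1 + B%:R / i.+1%:R) :> R.
  rewrite mulrDr mulr1 mulrCA [leLHS](_ : _ = (i + A).+1%:R + B%:R).
    rewrite lerD2l ler_peMr // ler_pdivlMr // mul1r ler_nat; lia.
  by rewrite -natrD; congr (_%:R); lia.
have := H i; rewrite addSn !addnS !factS !natrM.
move: (F i) (F (i + A)%N) (F (i + B)%N) (F (i + (A + B))%N).
move: (i`!%:R) ((i + A)`!%:R) ((i + B)`!%:R) ((i + (A + B))`!%:R) => t a b f.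
move: (i.+1%:R^-1) w0 w1 step => w w0 w1 step t0 a0 b0 f0 Hi.
apply: (@le_trans _ _ ((i + A).+1%:R * (1 + B%:R * w) * (a * b * (1 + K * w)))).
  rewrite mulrCA; apply: ler_pM => //; first by rewrite mulr_ge0 // ltW.
rewrite [leLHS](_ : _ = (i + A).+1%:R * a * b * ((1 + B%:R * w) * (1 + K * w)));
  last by ring.
apply: ler_wpM2l; first by rewrite !mulr_ge0 // ltW.
have : K * B%:R * (w * w) <= K * B%:R * w.
  by rewrite ler_wpM2l ?mulr_ge0 // ler_piMr // ltW.
by lra.
Qed.

Section two_factorials.
Variables (R : realType) (A B : nat).
Implicit Types x : R.

Definition fact2_coef (i : nat) : R := ((i + A)`!%:R * (i + B)`!%:R)^-1.

Lemma fact2_coef_gt0 i : 0 < fact2_coef i.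
Proof. by rewrite invr_gt0 mulr_gt0 // ltr0n fact_gt0. Qed.

Lemma fact2_coef_le i : fact2_coef i * i`!%:R <= i`!%:R^-1.
Proof.
have F n : 0 < n`!%:R :> R by rewrite ltr0n fact_gt0.
have L C : i`!%:R <= (i + C)`!%:R :> R by rewrite ler_nat leq_fact ?leq_addr.
rewrite /fact2_coef mulrC ler_pdivrMr ?mulr_gt0 // ler_pdivlMl //.
by rewrite ler_pM // ltW.
Qed.

Definition fact2_sum x := limn (series (fun i => x ^+ i * (fact2_coef i * i`!%:R))).

Lemma fact2_cvg x : 0 <= x ->
  cvgn (series (fun i => x ^+ i * (fact2_coef i * i`!%:R))).
Proof.
move=> x0; apply: (@series_le_cvg _ _ (exp_coeff x)).
- move=> i; rewrite mulr_ge0 ?exprn_ge0 // mulr_ge0 // ltW //.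
  exact: fact2_coef_gt0.
- by move=> i; exact: exp_coeff_ge0.
- by move=> i; rewrite ler_wpM2l ?exprn_ge0 // fact2_coef_le.
- exact: is_cvg_series_exp_coeff.
Qed.

Lemma fact2_coef_ge i : ((i + (A + B))`!%:R)^-1 <= fact2_coef i * i`!%:R :> R.
Proof.
have F n : 0 < n`!%:R :> R by rewrite ltr0n fact_gt0.
rewrite /fact2_coef [leRHS]mulrC ler_pdivlMr ?mulr_gt0 // mulrC ler_pdivrMr //.
rewrite -!natrM ler_nat; elim: A => [|a IH]; first by rewrite addn0 add0n.
rewrite addSn !addnS !factS -mulnA [leqRHS]mulnCA leq_mul //.
by lia.
Qed.

(** Termwise comparison with the exponential series shifted by A+B and, for the
    error, by A+B+1. *)
Lemma fact2_sum_asymp : exists2 K : R, 0 <= K & forall x, 0 < x ->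
  `|fact2_sum x * x ^+ (A + B) * expR (- x) - 1| <= K / x.
Proof.
have [K K0 HK] := fact_ratio_le R A B.
set M := (A + B)%N in HK *.
exists ((M * M)%:R + K) => [|x x0]; first by rewrite addr_ge0.
have [c1 _] := exp_tail M x0; have [c2 _] := exp_tail M.+1 x0.
have c0 := fact2_cvg (ltW x0).
have lo : limn (series (fun i => x ^+ i / (i + M)`!%:R)) <= fact2_sum x.
  apply: lim_series_le => // i.
  by rewrite ler_wpM2l ?exprn_ge0 ?fact2_coef_ge // ltW.
have hi : fact2_sum x <= limn (series (fun i => x ^+ i / (i + M)`!%:R))
    + K * limn (series (fun i => x ^+ i / (i + M.+1)`!%:R)).
  have cZ := is_cvg_seriesZ (k := K) c2.
  rewrite -[K * _](lim_seriesZ _ c2) -lim_seriesD //.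
  apply: lim_series_le => //; first exact: is_cvg_seriesD.
  move=> i; rewrite !fctE /GRing.scale /= [K * _]mulrCA -mulrDr.
  apply: ler_wpM2l; first by rewrite exprn_ge0 // ltW.
  by rewrite mulrC; exact: HK.
have e0 := expR_gt0 x; have xM : 0 < x ^+ M by rewrite exprn_gt0.
have t1 := exp_tail_le M x0; have t2 := exp_tail_le M.+1 x0.
have t3 := exp_tail_ge M x0.
have lo' : expR x * (1 - (M * M)%:R / x) <= fact2_sum x * x ^+ M.
  by apply: (le_trans t3); rewrite mulrC ler_pM2r.
have hi' : fact2_sum x * x ^+ M <= expR x * (1 + K / x).
  rewrite -(ler_pM2r xM) in hi; apply: (le_trans hi).
  rewrite exprS in t2; move: t1 t2.
  move: (limn _) (limn _) (x ^+ M) => S2 S1 P t1 t2.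
  rewrite [leLHS](_ : _ = P * S1 + K / x * (x * P * S2)); last first.
    by field; rewrite gt_eqF.
  rewrite mulrDr mulr1 lerD // [leRHS]mulrC ler_wpM2l //.
  by rewrite mulr_ge0 // invr_ge0 ltW.
rewrite expRN.
have -> : fact2_sum x * x ^+ M / expR x - 1
  = (fact2_sum x * x ^+ M - expR x) / expR x by field; rewrite gt_eqF.
rewrite normrM normfV (gtr0_norm e0) ler_pdivrMr // ler_norml.
have -> : ((M * M)%:R + K) / x * expR x
  = expR x * ((M * M)%:R / x) + expR x * (K / x) by ring.
have g1 : 0 <= expR x * (K / x) by rewrite !mulr_ge0 // ?invr_ge0 ltW.
have g2 : 0 <= expR x * ((M * M)%:R / x) by rewrite !mulr_ge0 // ?invr_ge0 ltW.
rewrite mulrBr mulr1 in lo'; rewrite mulrDr mulr1 in hi'.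
by apply/andP; split; lra.
Qed.

(** A single term already dominates the quadratic growth that locating the
    zeros requires; the exponential growth matters only for the asymptotics. *)
Lemma fact2_sum_ge x : 0 <= x -> x ^+ 2 * (fact2_coef 2 * 2) <= fact2_sum x.
Proof.
move=> x0; apply: (lim_series_ge_term 2 (fact2_cvg x0)) => i.
by rewrite mulr_ge0 ?exprn_ge0 // mulr_ge0 // ltW // fact2_coef_gt0.
Qed.

End two_factorials.

(** * The tail of Kummer's series *)
Section tail_factors.
Variables (R : realType) (m : nat).
Hypothesis m_gt0 : (0 < m)%N.
Implicit Types s : R.

(** The factors of [kummer_coef] that come after the small one m s - 1. *)
Definition tail_prod s i : R := \prod_(j < i) ((m.+1 + j)%:R * s - 1).

Lemma tail_prodS s i :
  tail_prod s i.+1 = tail_prod s i * ((m.+1 + i)%:R * s - 1).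
Proof. by rewrite /tail_prod big_ord_recr. Qed.

(** The hypothesis 2 <= (2m+1) s is the left end of the window around 1/m; it
    keeps these factors away from 0, uniformly in j. *)
Lemma tail_factor_ge s j : 2 <= (2 * m + 1)%:R * s ->
  j.+1%:R / (2 * m + 1)%:R <= (m.+1 + j)%:R * s - 1.
Proof.
move=> s2; have m0 : 0 < (2 * m + 1)%:R :> R by rewrite ltr0n addn1.
rewrite ler_pdivrMr // mulrBl mul1r mulrAC -mulrA.
have : (m.+1 + j)%:R * 2 <= (m.+1 + j)%:R * ((2 * m + 1)%:R * s) by rewrite ler_wpM2l.
have : (2 * m + 1 + j.+1)%:R <= ((m.+1 + j) * 2)%:R :> R by rewrite ler_nat; lia.
rewrite (natrD _ (2 * m + 1) j.+1) natrM.
by move: ((2 * m + 1)%:R) ((m.+1 + j)%:R) (j.+1%:R) => a b c; lra.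
Qed.

Lemma tail_factor_le s j : m%:R * s <= 1 ->
  (m.+1 + j)%:R * s - 1 <= j.+1%:R / m%:R.
Proof.
move=> s1; have m0 : 0 < m%:R :> R by rewrite ltr0n.
rewrite ler_pdivlMr // mulrBl mul1r -mulrA [s * _]mulrC.
have := ler_wpM2l (ler0n R (m.+1 + j)) s1.
rewrite !natrD -!nat1r; lra.
Qed.

Lemma tail_prod_ge s i : 2 <= (2 * m + 1)%:R * s ->
  i`!%:R / (2 * m + 1)%:R ^+ i <= tail_prod s i.
Proof.
move=> s2; elim: i => [|i IH].
  by rewrite /tail_prod big_ord0 expr0 divr1.
rewrite tail_prodS factS natrM exprSr invfM mulrCA !mulrA.
rewrite [leLHS](_ : _ = i`!%:R / (2 * m + 1)%:R ^+ i * (i.+1%:R / (2 * m + 1)%:R));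
  last by ring.
by rewrite ler_pM ?tail_factor_ge // divr_ge0 // exprn_ge0.
Qed.

Lemma tail_prod_gt0 s i : 2 <= (2 * m + 1)%:R * s -> 0 < tail_prod s i.
Proof.
move=> s2; apply: lt_le_trans (tail_prod_ge i s2).
by rewrite divr_gt0 ?exprn_gt0 ?ltr0n ?fact_gt0 // addn1.
Qed.

Lemma tail_prod_eq s i : m%:R * s = 1 -> tail_prod s i = i`!%:R / m%:R ^+ i.
Proof.
move=> s1; have m0 : m%:R != 0 :> R by rewrite pnatr_eq0 -lt0n.
have -> : s = m%:R^-1 by rewrite -[LHS](mulKf m0) s1 mulr1.
elim: i => [|i IH]; first by rewrite /tail_prod big_ord0 expr0 divr1.
rewrite tail_prodS IH factS natrM exprSr natrD -!nat1r.
by field; rewrite m0 expf_neq0.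
Qed.

(** Each factor has slope m+1+j in s, at most (m+1) (2m+1) times its value by
    [tail_factor_ge]; so a product of i factors has relative Lipschitz constant
    O(i). *)
Lemma tail_prod_lip s1 s2 i : 2 <= (2 * m + 1)%:R * s1 -> s1 <= s2 ->
  0 <= tail_prod s2 i - tail_prod s1 i
    <= (s2 - s1) * (m.+1 * (2 * m + 1) * i)%:R * tail_prod s2 i.
Proof.
move=> h1 h12; have m0 : 0 < (2 * m + 1)%:R :> R by rewrite ltr0n addn1.
have h2 : 2 <= (2 * m + 1)%:R * s2 by apply: (le_trans h1); rewrite ler_pM2l.
elim: i => [|i /andP[IH1 IH2]].
  by rewrite /tail_prod !big_ord0 subrr muln0 mulr0 mul0r lexx.
rewrite !tail_prodS.
have p1 := tail_prod_gt0 i h1; have p2 := tail_prod_gt0 i h2.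
have f1 : 0 <= (m.+1 + i)%:R * s1 - 1.
  by apply: le_trans (tail_factor_ge i h1); rewrite divr_ge0.
have f2 := tail_factor_ge i h2.
have f12 : (m.+1 + i)%:R * s1 - 1 <= (m.+1 + i)%:R * s2 - 1.
  by rewrite lerD2r ler_wpM2l.
have Kf : (m.+1 + i)%:R <= (m.+1 * (2 * m + 1))%:R * ((m.+1 + i)%:R * s2 - 1).
  rewrite ler_pdivrMr // in f2.
  apply: (@le_trans _ _ (m.+1%:R * i.+1%:R)).
    by rewrite -natrM ler_nat mulnS leq_add2l leq_pmull.
  by rewrite natrM -mulrA ler_wpM2l // mulrC.
have E : (m.+1 + i)%:R * s2 - 1 - ((m.+1 + i)%:R * s1 - 1)
  = (m.+1 + i)%:R * (s2 - s1) by ring.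
move: (_ * s1 - 1) (_ * s2 - 1) f1 f2 f12 Kf E => d1 d2 f1 f2 f12 Kf E.
move: (tail_prod s1 i) (tail_prod s2 i) p1 p2 IH1 IH2 => D1 D2 p1 p2 IH1 IH2.
apply/andP; split.
  rewrite subr_ge0 in IH1; rewrite subr_ge0.
  by apply: ler_pM => //; exact: ltW.
have -> : D2 * d2 - D1 * d1 = D2 * (d2 - d1) + (D2 - D1) * d1 by ring.
have -> : (s2 - s1) * (m.+1 * (2 * m + 1) * i.+1)%:R * (D2 * d2) =
  D2 * ((m.+1 * (2 * m + 1))%:R * d2 * (s2 - s1))
  + (s2 - s1) * (m.+1 * (2 * m + 1) * i)%:R * D2 * d2.
  by rewrite mulnS natrD; ring.
apply: lerD; last exact: ler_pM.
by rewrite E; apply: ler_wpM2l; [exact: ltW|rewrite ler_wpM2r // subr_ge0].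
Qed.

End tail_factors.

Section kummer_tail.
Variables (R : realType) (l N : nat).
Implicit Types s x : R.

Let m := (l + N).+1.
Let A := N.+1.
Let B := (m + l).+1.
Let m_gt0 : (0 < m)%N := ltn0Sn _.

(** The cofactor of (m s - 1) in the terms of degree > N of Kummer's series,
    without the constants and powers that [kummer_split] puts in front. *)
Definition kummer_tail s x : R :=
  limn (series (fun i => x ^+ i * (fact2_coef R A B i * tail_prod m s i))).

Lemma kummer_tail_cvg s x : 0 <= s -> 0 <= x ->
  cvgn (series (fun i => x ^+ i * (fact2_coef R A B i * tail_prod m s i))).
Proof.
move=> s0 x0; apply: normed_cvg.
have D0 : 0 <= m.+1%:R * (s + 1) by rewrite mulr_ge0 // addr_ge0.
have P i : `|tail_prod m s i| <= (m.+1%:R * (s + 1)) ^+ i * i`!%:R.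
  elim: i => [|i IH]; first by rewrite /tail_prod big_ord0 normr1 expr0 mulr1.
  rewrite tail_prodS normrM exprSr factS natrM.
  rewrite [leRHS](_ : _ = (m.+1%:R * (s + 1)) ^+ i * i`!%:R
    * (m.+1%:R * (s + 1) * i.+1%:R)); last by ring.
  rewrite ler_pM //.
  rewrite (le_trans (ler_normB _ _)) // normr1 ger0_norm ?mulr_ge0 //.
  rewrite -mulrA [_ * i.+1%:R]mulrC mulrA -natrM mulrDr mulr1 lerD //.
    by rewrite ler_wpM2r // ler_nat mulnS leq_add2l leq_pmull.
  by rewrite ler1n muln_gt0.
apply: (@series_le_cvg _ _ (fun i => (x * (m.+1%:R * (s + 1))) ^+ i
  * (fact2_coef R A B i * i`!%:R))) => //.
- by move=> i; exact: normr_ge0.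
- move=> i; rewrite mulr_ge0 ?exprn_ge0 // mulr_ge0 //.
  by rewrite ltW // fact2_coef_gt0.
- move=> i /=; rewrite !normrM (ger0_norm (exprn_ge0 _ x0)).
  rewrite (gtr0_norm (fact2_coef_gt0 _ _ _ _)) exprMn -[leRHS]mulrA.
  rewrite ler_wpM2l ?exprn_ge0 // [leRHS]mulrCA ler_wpM2l //.
  by rewrite ltW // fact2_coef_gt0.
- by apply: fact2_cvg; rewrite mulr_ge0.
Qed.

Lemma kummer_split s x : 0 <= s -> 0 <= x -> kummer l s x =
  \sum_(k < N.+1) kummer_coef l s k * x ^+ k
  + (2 * l + 1)`!%:R * x ^+ N.+1 * \prod_(j < N) ((l + 1 + j)%:R * s - 1)
    * (m%:R * s - 1) * kummer_tail s x.
Proof.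
move=> s0 x0; rewrite /kummer /pseries.
have cK := exp_dominated_cvg (x := x) (kummer_coef_dominated l s0).
have [_ ->] := series_split N.+1 cK.
congr (_ + _); rewrite -[RHS](lim_seriesZ _ (kummer_tail_cvg s0 x0)).
congr (limn (series _)); apply/funext => i.
rewrite /GRing.scale /= /kummer_coef big_split_ord /= big_ord_recr /= exprD.
rewrite (_ : (l + 1 + N) = m)%N; last by rewrite addn1 addSn.
rewrite /tail_prod /fact2_coef.
under [X in _ * X * _ * _ = _]eq_bigr do rewrite addnA addnS.
rewrite (_ : (2 * l + 1 + (N.+1 + i)) = i + B)%N; last by rewrite /B /m; lia.
rewrite (_ : (N.+1 + i) = i + A)%N; last by rewrite /A; lia.
rewrite (eq_bigr (fun j : 'I_i => (m.+1 + j)%:R * s - 1)); last first.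
  by move=> j _ /=; do 3 f_equal; rewrite /m; lia.
rewrite /GRing.scale /= [(i + B)`!%:R * _]mulrC.
by move: (_^-1) (\prod_(_ < i) _) => a b; ring.
Qed.

Lemma kummer_tail_ge0 s x : 0 <= s -> 0 <= x -> 2 <= (2 * m + 1)%:R * s ->
  0 <= kummer_tail s x.
Proof.
move=> s0 x0 s2; apply: lim_series_ge0 => [|i]; first exact: kummer_tail_cvg.
by rewrite mulr_ge0 ?exprn_ge0 // mulr_ge0 // ltW ?fact2_coef_gt0 ?tail_prod_gt0.
Qed.

Lemma kummer_tail_ge s x : 0 <= s -> 0 <= x -> 2 <= (2 * m + 1)%:R * s ->
  fact2_sum A B (x / (2 * m + 1)%:R) <= kummer_tail s x.
Proof.
move=> s0 x0 s2; apply: lim_series_le => [||i].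
- by apply: fact2_cvg; rewrite divr_ge0.
- exact: kummer_tail_cvg.
- rewrite expr_div_n -mulrA ler_wpM2l ?exprn_ge0 // mulrCA ler_wpM2l //.
    by rewrite ltW // fact2_coef_gt0.
  by rewrite mulrC tail_prod_ge.
Qed.

Lemma kummer_tail_eq s x : m%:R * s = 1 -> kummer_tail s x = fact2_sum A B (x / m%:R).
Proof.
move=> s1; congr (limn (series _)); apply/funext => i.
by rewrite tail_prod_eq // expr_div_n; ring.
Qed.

(** By [tail_prod_lip] the difference is at most (s2 - s1) K times the series
    with terms i t_i, and i.+1 * t_(i+1) <= x t_i: the factor i costs only a
    factor x. *)
Lemma kummer_tail_lip s1 s2 x : 0 <= x -> 0 <= s1 -> s1 <= s2 ->
  2 <= (2 * m + 1)%:R * s1 -> m%:R * s2 <= 1 ->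
  0 <= kummer_tail s2 x - kummer_tail s1 x
    <= (s2 - s1) * (m.+1 * (2 * m + 1))%:R * x * kummer_tail s2 x.
Proof.
move=> x0 s10 s12 h1 h2; have s20 := le_trans s10 s12.
have h2' : 2 <= (2 * m + 1)%:R * s2 by apply: (le_trans h1); rewrite ler_wpM2l.
have c1 := kummer_tail_cvg s10 x0; have c2 := kummer_tail_cvg s20 x0.
rewrite /kummer_tail -lim_seriesB //.
set d := (X in series X); have cd : cvgn (series d) by exact: is_cvg_seriesB.
have dE i : d i = x ^+ i * (fact2_coef R A B i * (tail_prod m s2 i - tail_prod m s1 i)).
  by rewrite /d !fctE; ring.
have d0 i : 0 <= d i.
  have /andP[p _] := tail_prod_lip m_gt0 i h1 s12.
  by rewrite dE mulr_ge0 ?exprn_ge0 // mulr_ge0 // ltW // fact2_coef_gt0.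
apply/andP; split; first exact: lim_series_ge0.
(* the term of index 0 is a difference of empty products *)
have [cd' ->] := series_split 1 cd.
rewrite big_ord1 (_ : d 0 = 0) ?add0r; last first.
  by rewrite dE /tail_prod !big_ord0 subrr !mulr0.
rewrite -[leRHS](lim_seriesZ _ c2); apply: lim_series_le => //.
  exact: is_cvg_seriesZ.
move=> i; rewrite add1n dE /GRing.scale /=.
have /andP[_ p] := tail_prod_lip m_gt0 i.+1 h1 s12.
have K0 : 0 <= (s2 - s1) * (m.+1 * (2 * m + 1))%:R * x.
  by rewrite !mulr_ge0 // subr_ge0.
have D0 : 0 < tail_prod m s2 i by exact: tail_prod_gt0.
have e0 := fact2_coef_gt0 R A B i.
have f0 : 0 < m%:R :> R by rewrite ltr0n.
apply: (@le_trans _ _ (x ^+ i.+1 * (fact2_coef R A B i.+1 *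
  ((s2 - s1) * (m.+1 * (2 * m + 1) * i.+1)%:R * tail_prod m s2 i.+1)))).
  rewrite ler_wpM2l ?exprn_ge0 // ler_wpM2l //.
  by rewrite ltW // fact2_coef_gt0.
rewrite tail_prodS natrM exprS.
rewrite [leLHS](_ : _ = (s2 - s1) * (m.+1 * (2 * m + 1))%:R * x * (x ^+ i *
  (fact2_coef R A B i.+1 * i.+1%:R * ((m.+1 + i)%:R * s2 - 1) * tail_prod m s2 i)));
  last by ring.
rewrite ler_wpM2l // ler_wpM2l ?exprn_ge0 // ler_wpM2r ?(ltW D0) //.
have q1 := tail_factor_le m_gt0 i h2.
apply: (@le_trans _ _ (fact2_coef R A B i.+1 * i.+1%:R * (i.+1%:R / m%:R))).
  by rewrite ler_wpM2l // mulr_ge0 // ltW // fact2_coef_gt0.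
rewrite /fact2_coef !addSn !factS !natrM.
have a0 : 0 < (i + A)`!%:R :> R by rewrite ltr0n fact_gt0.
have b0 : 0 < (i + B)`!%:R :> R by rewrite ltr0n fact_gt0.
have a1 : 0 < (i + A).+1%:R :> R by rewrite ltr0n.
have b1 : 0 < (i + B).+1%:R :> R by rewrite ltr0n.
have i1 : 0 < i.+1%:R :> R by rewrite ltr0n.
have H : i.+1%:R * i.+1%:R <= (i + A).+1%:R * (i + B).+1%:R * m%:R :> R.
  rewrite -!natrM ler_nat; apply: (@leq_trans ((i + A).+1 * (i + B).+1)).
    by rewrite leq_mul // ltnS leq_addr.
  by rewrite leq_pmulr.
move: ((i + A)`!%:R) ((i + B)`!%:R) ((i + A).+1%:R) ((i + B).+1%:R) a0 b0 a1 b1 H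
  => a b a' b' a0 b0 a1 b1 H.
rewrite [leLHS](_ : _ = (a * b)^-1 * (i.+1%:R * i.+1%:R / (a' * b' * m%:R))).
  apply: ler_piMr; first by rewrite ltW // invr_gt0 mulr_gt0.
  by rewrite ler_pdivrMr ?mul1r // !mulr_gt0.
by field; rewrite !gt_eqF.
Qed.

End kummer_tail.

(** * Zeros of a balance with a stiff right-hand side *)

Lemma lipschitz_within_continuous (R : realType) (f : R -> R) (a b L : R) :
  (forall s t, a <= s <= b -> a <= t <= b -> `|f s - f t| <= L * `|s - t|) ->
  {within `[a, b], continuous f}.
Proof.
move=> Lf; apply/subspace_continuousP => x /=; rewrite in_itv /= => xab.
apply/cvgrPdist_le => e e0; rewrite near_withinE; near=> y.
rewrite /= in_itv /= => yab; apply: (le_trans (Lf _ _ xab yab)).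
have L1 : 0 < `|L| + 1 by rewrite ltr_wpDl.
apply: (@le_trans _ _ ((`|L| + 1) * `|x - y|)).
  by rewrite ler_wpM2r // (le_trans (ler_norm _)) // lerDl.
rewrite mulrC -ler_pdivlMr //; near: y.
rewrite near_simpl; apply/nbhs_ballP; exists (e / (`|L| + 1)); first by rewrite /= divr_gt0.
by move=> z /=; rewrite /ball /= => /ltW.
Unshelve. all: by end_near. Qed.

Lemma ratio_near1 (R : realType) (u g e1 e2 : R) :
  `|u - 1| <= e1 -> `|g - 1| <= e2 -> e2 <= 1 / 2 ->
  `|u / g - 1| <= 2 * (e1 + e2).
Proof.
move=> ue ge e2h; have g0 : 1 / 2 <= g by move: ge; rewrite ler_norml => /andP[]; lra.
have gp : 0 < g by lra.
have -> : u / g - 1 = ((u - 1) - (g - 1)) / g by field; rewrite gt_eqF.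
rewrite normrM normfV (gtr0_norm gp) ler_pdivrMr // (le_trans (ler_normB _ _)) //.
rewrite (le_trans (lerD ue ge)) //.
have e0 : 0 <= e1 + e2.
  exact: addr_ge0 (le_trans (normr_ge0 _) ue) (le_trans (normr_ge0 _) ge).
by have := ler_wpM2l e0 g0; lra.
Qed.

(** The size of the root of c + e(s) = (1 - m s) t(s) in terms of the value T
    of t at 1/m instead of its value at the root. *)
Lemma perturbed_ratio (R : realType) (c e eta tau t T d : R) :
  0 < c -> `|e| <= eta -> eta <= c / 2 -> 0 < t -> c + e = tau * t ->
  0 <= T - t <= d * T -> d <= 1 / 2 ->
  `|tau * T / c - 1| <= eta / c + 3 * d.
Proof.
move=> c0 ee etac t0 E /andP[tT Td] d1.
have T0 : 0 < T by lra.
have dT : d * T <= 1 / 2 * T by rewrite ler_wpM2r // ltW.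
have d0 : 0 <= d by rewrite -(pmulr_lge0 _ T0); lra.
have Tt : T - t <= 2 * d * t.
  have : d * T <= d * (2 * t) by apply: ler_wpM2l => //; lra.
  by lra.
have -> : tau * T / c - 1 = e / c + (c + e) / c * ((T - t) / t).
  have es : e = tau * t - c by rewrite -E; ring.
  by rewrite E es; field; rewrite !gt_eqF.
rewrite (le_trans (ler_normD _ _)) // lerD //.
  by rewrite normrM normfV (gtr0_norm c0) ler_pM2r ?invr_gt0.
move: ee; rewrite ler_norml => /andP[e1 e2].
have p0 : 0 <= (c + e) / c by rewrite divr_ge0 ?(ltW c0) //; lra.
rewrite ger0_norm; last by rewrite mulr_ge0 // divr_ge0 // ltW.
rewrite [leRHS](_ : _ = 3 / 2 * (2 * d)); last by field.
by rewrite ler_pM // ?ler_pdivrMr // ?divr_ge0 ?(ltW t0) //; lra.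
Qed.

(** Existence is the intermediate value theorem between 2/(2m+1), where
    t is too large, and 1/m, where the right-hand side vanishes; to the right of
    1/m it is nonpositive while c + e(s) > 0.  For uniqueness, between two roots
    s1 < s2 the factor 1 - m s loses m (s2 - s1) t(s1) >= m (s2 - s1) M, whereas
    e and the growth of t contribute at most (s2 - s1) (L + 2 c k). *)
Lemma perturbed_zero (R : realType) (m c L M k eta : R) (e t : R -> R) :
  1 <= m -> 0 < c -> 0 < M -> 0 <= k ->
  (forall s, 2 <= (2 * m + 1) * s -> (2 * m - 1) * s <= 2 -> `|e s| <= eta) ->
  (forall s s', 2 <= (2 * m + 1) * s -> (2 * m - 1) * s <= 2 ->
     2 <= (2 * m + 1) * s' -> (2 * m - 1) * s' <= 2 ->
     `|e s - e s'| <= L * `|s - s'|) ->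
  (forall s, 2 <= (2 * m + 1) * s -> 0 <= t s) ->
  (forall s, 2 <= (2 * m + 1) * s -> M <= t s) ->
  (forall s s', s <= s' -> 2 <= (2 * m + 1) * s -> m * s' <= 1 ->
     0 <= t s' - t s <= (s' - s) * k * t s') ->
  eta <= c / 2 -> 2 * c * (2 * m + 1) < M -> L + 2 * c * k < m * M ->
  4 * c * k <= m * M ->
  exists s : R, [/\ 2 < (2 * m + 1) * s /\ m * s < 1,
    c + e s = (1 - m * s) * t s,
    (forall s', 2 <= (2 * m + 1) * s' -> (2 * m - 1) * s' <= 2 ->
       c + e s' = (1 - m * s') * t s' -> s' = s),
    `|(1 - m * s) * t m^-1 / c - 1| <= eta / c + 6 * c * k / (m * M) &
    1 - m * s <= 2 * c / M].
Proof.
move=> m1 c0 M0 k0 eB eL t0 tM tL etac Mc Lc kc.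
have m0 : 0 < m by lra.
have m21 : 0 < 2 * m + 1 by lra.
have m21' : 0 < 2 * m - 1 by lra.
(* a and b bound the part of the window where m s <= 1 *)
pose a := 2 / (2 * m + 1); pose b := m^-1.
have aE : (2 * m + 1) * a = 2 by rewrite /a; field; rewrite gt_eqF.
have bE : m * b = 1 by rewrite /b divff // gt_eqF.
have ab : a < b.
  by rewrite -(ltr_pM2l m21) aE mulrDl -mulrA bE mul1r mulr1 ltrDl /b invr_gt0.
have b0 : 0 < b by rewrite invr_gt0.
have a0 : 0 < a by rewrite divr_gt0.
have sub s : a <= s <= b ->
    [/\ 2 <= (2 * m + 1) * s, (2 * m - 1) * s <= 2 & m * s <= 1].
  case/andP=> h1 h2; have h3 : m * s <= 1 by rewrite -bE ler_pM2l.
  split=> //; first by rewrite -[leLHS]aE ler_pM2l.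
  by have := lt_le_trans a0 h1; lra.
pose F s := c + e s - (1 - m * s) * t s.
have FL s s' : a <= s <= b -> a <= s' <= b -> s <= s' ->
    `|F s - F s'| <= (L + (m + k) * t b) * `|s - s'|.
  move=> sab s'ab ss'.
  have [h1 h2 h3] := sub s sab; have [h1' h2' h3'] := sub s' s'ab.
  have /andP[q1 q2] := tL s s' ss' h1 h3'.
  have [hb1 hb2 hb3] : [/\ 2 <= (2 * m + 1) * b, (2 * m - 1) * b <= 2 & m * b <= 1].
    by apply: sub; rewrite lexx ltW.
  have s'b : s' <= b by case/andP: s'ab.
  have /andP[q3 _] := tL s' b s'b h1' hb3.
  have E := eL s s' h1 h2 h1' h2'.
  have -> : F s - F s' = (e s - e s') + ((1 - m * s) * (t s' - t s) - m * (s' - s) * t s').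
    by rewrite /F; ring.
  have D : `|s - s'| = s' - s by rewrite distrC ger0_norm // subr_ge0.
  have d0 : 0 <= s' - s by rewrite subr_ge0.
  have s0 : 0 <= m * s by case/andP: sab => g _; rewrite mulr_ge0 ?(ltW m0) // (le_trans (ltW a0)).
  have w1 : (s' - s) * k * t s' <= (s' - s) * k * t b by rewrite ler_wpM2l ?mulr_ge0 // -subr_ge0.
  have w2 : m * (s' - s) * t s' <= m * (s' - s) * t b.
    by rewrite ler_wpM2l ?mulr_ge0 ?(ltW m0) // -subr_ge0.
  have w3 : 0 <= m * (s' - s) * t s' by rewrite !mulr_ge0 ?t0 ?(ltW m0).
  have w4 : 0 <= (1 - m * s) * (t s' - t s) by rewrite mulr_ge0 // subr_ge0.
  have w5 : 0 <= (m * s) * (t s' - t s) by rewrite mulr_ge0.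
  rewrite D in E *; move: E; rewrite !ler_norml => /andP[E1 E2].
  by apply/andP; lra.
have Fc : {within `[a, b], continuous F}.
  apply: (@lipschitz_within_continuous _ _ _ _ (L + (m + k) * t b)) => s s' sab s'ab.
  have [h|/ltW h] := leP s s'; first exact: FL.
  by rewrite distrC [`|s - s'|]distrC; exact: FL.
have [ha1 ha2 ha3] : [/\ 2 <= (2 * m + 1) * a, (2 * m - 1) * a <= 2 & m * a <= 1].
  by apply: sub; rewrite lexx ltW.
have [hb1 hb2 hb3] : [/\ 2 <= (2 * m + 1) * b, (2 * m - 1) * b <= 2 & m * b <= 1].
  by apply: sub; rewrite lexx ltW.
have Fb : 0 < F b.
  by rewrite /F bE subrr mul0r subr0; have := eB b hb1 hb2; rewrite ler_norml; lra.
have Fa : F a < 0.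
  rewrite /F; have := eB a ha1 ha2; rewrite ler_norml => /andP[_ ea].
  have -> : 1 - m * a = (2 * m + 1)^-1 by rewrite /a; field; rewrite gt_eqF.
  have : 2 * c < (2 * m + 1)^-1 * t a.
    by rewrite ltr_pdivlMl // mulrC; apply: lt_le_trans (tM a ha1).
  lra.
have [s] : exists2 s, s \in `[a, b] & F s = 0.
  by apply: IVT => //; rewrite ?(ltW ab) // ge_min (ltW Fa) /= le_max (ltW Fb) orbT.
rewrite in_itv /= => sab Fs.
have [h1 h2 h3] := sub s sab.
have Ez : c + e s = (1 - m * s) * t s by apply/eqP; rewrite -subr_eq0 -/(F s) Fs.
have eP s' : 2 <= (2 * m + 1) * s' -> (2 * m - 1) * s' <= 2 ->
    c / 2 <= c + e s' <= 3 * c / 2.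
  by move=> g1 g2; have := eB s' g1 g2; rewrite ler_norml => /andP[? ?]; apply/andP; lra.
have left s' : 2 <= (2 * m + 1) * s' -> (2 * m - 1) * s' <= 2 ->
    c + e s' = (1 - m * s') * t s' -> m * s' < 1.
  move=> g1 g2 z; have /andP[p _] := eP s' g1 g2.
  rewrite ltNge; apply/negP => ms.
  have : (1 - m * s') * t s' <= 0 by rewrite mulr_le0_ge0 ?t0 // subr_le0.
  by rewrite -z; lra.
have uniq s1 s2 : s1 <= s2 -> 2 <= (2 * m + 1) * s1 -> (2 * m - 1) * s1 <= 2 ->
    2 <= (2 * m + 1) * s2 -> (2 * m - 1) * s2 <= 2 ->
    c + e s1 = (1 - m * s1) * t s1 -> c + e s2 = (1 - m * s2) * t s2 -> s1 = s2.
  move=> s12 g1 g2 g3 g4 z1 z2; apply/eqP; rewrite eq_le s12 leNgt; apply/negP => lt12.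
  have d0 : 0 < s2 - s1 by rewrite subr_gt0.
  have l2 := left s2 g3 g4 z2.
  have /andP[q1 q2] := tL s1 s2 s12 g1 (ltW l2).
  have /andP[p1 p2] := eP s2 g3 g4.
  have E := eL s1 s2 g1 g2 g3 g4.
  have Dn : `|s1 - s2| = s2 - s1 by rewrite distrC gtr0_norm.
  have {E} := le_trans (ler_norm _) E; rewrite Dn.
  have -> : e s1 - e s2 = m * (s2 - s1) * t s1 - (1 - m * s2) * (t s2 - t s1).
    have -> : e s1 - e s2 = (c + e s1) - (c + e s2) by ring.
    by rewrite z1 z2; ring.
  have u1 : (1 - m * s2) * (t s2 - t s1) <= (s2 - s1) * (2 * c * k).
    apply: (@le_trans _ _ ((1 - m * s2) * ((s2 - s1) * k * t s2))).
      by rewrite ler_wpM2l // subr_ge0 ltW.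
    rewrite [leLHS](_ : _ = (s2 - s1) * k * ((1 - m * s2) * t s2)); last by ring.
    rewrite -z2 [leRHS](_ : _ = (s2 - s1) * k * (2 * c)); last by ring.
    by rewrite ler_wpM2l ?mulr_ge0 ?(ltW d0) //; lra.
  have u2 : m * (s2 - s1) * M <= m * (s2 - s1) * t s1.
    by rewrite ler_wpM2l ?tM // mulr_ge0 // ltW.
  have u3 : (s2 - s1) * (L + 2 * c * k) < (s2 - s1) * (m * M) by rewrite ltr_pM2l.
  lra.
have tau_gt0 : 0 < 1 - m * s by rewrite subr_gt0 left.
have ts0 : 0 < t s by apply: lt_le_trans (tM s h1).
have tau_le : 1 - m * s <= 2 * c / M.
  rewrite ler_pdivlMr //; apply: (@le_trans _ _ ((1 - m * s) * t s)).
    by rewrite ler_wpM2l ?tM // ltW.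
  by rewrite -Ez; have /andP[_ p] := eP s h1 h2; lra.
exists s; split => //.
- split; last by rewrite -subr_gt0.
  rewrite -[ltLHS]aE ltr_pM2l // lt_neqAle; case/andP: (sab) => -> _; rewrite andbT.
  by apply/eqP => aEs; move: Fa; rewrite aEs Fs ltxx.
- move=> s' g1 g2 z; have [h|/ltW h] := leP s s'.
    exact/esym/(uniq s s').
  exact: (uniq s' s).
have sb : s <= b by case/andP: sab.
have tsb := tL s b sb h1 hb3.
have mM : 0 < m * M by rewrite mulr_gt0.
have bs : (b - s) * k <= 2 * c * k / (m * M).
  rewrite ler_pdivlMr // [leLHS](_ : _ = k * (M * (m * b - m * s))); last by ring.
  rewrite bE [leRHS]mulrC; apply: ler_wpM2l => //.
  by rewrite mulrC -ler_pdivlMr.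
have ths : 2 * c * k / (m * M) <= 1 / 2.
  by rewrite ler_pdivrMr //; move: kc; clear; lra.
have -> : 6 * c * k / (m * M) = 3 * (2 * c * k / (m * M)) by ring.
apply: (le_trans (perturbed_ratio c0 (eB s h1 h2) etac ts0 Ez tsb (le_trans bs ths))).
by rewrite lerD2l ler_wpM2l.
Qed.

Section bounded_lipschitz.
Variables (R : realType) (J : R -> Prop).

Definition bounded_lipschitz (f : R -> R) :=
  exists2 L : R, 0 <= L & forall s s', J s -> J s' ->
    `|f s| <= L /\ `|f s - f s'| <= L * `|s - s'|.

Lemma bounded_lipschitz_cst (c : R) : bounded_lipschitz (fun=> c).
Proof. by exists `|c| => // s s' _ _; rewrite subrr normr0 mulr_ge0. Qed.

Lemma bounded_lipschitzM (f g : R -> R) :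
  bounded_lipschitz f -> bounded_lipschitz g ->
  bounded_lipschitz (fun s => f s * g s).
Proof.
move=> [L L0 fL] [K K0 gK]; exists (L * K + L * K); first by rewrite addr_ge0 ?mulr_ge0.
move=> s s' Js Js'.
have [f1 f2] := fL s s' Js Js'; have [g1 g2] := gK s s' Js Js'.
have [g3 _] := gK s' s Js' Js.
have LK0 : 0 <= L * K by rewrite mulr_ge0.
split; first by rewrite normrM (le_trans (ler_pM _ _ f1 g1)) // lerDl.
rewrite (_ : _ - _ = f s * (g s - g s') + (f s - f s') * g s'); last by ring.
rewrite (le_trans (ler_normD _ _)) // !normrM mulrDl lerD //.
  by rewrite -mulrA ler_pM.
by rewrite mulrAC ler_pM.
Qed.

Lemma bounded_lipschitz_inv (a c : R) : 0 < c ->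
  (forall s, J s -> a * s - 1 <= - c) ->
  bounded_lipschitz (fun s => (a * s - 1)^-1).
Proof.
move=> c0 H; exists (c^-1 + `|a| / c ^+ 2).
  by rewrite addr_ge0 ?divr_ge0 ?invr_ge0 ?exprn_ge0 // ltW.
move=> s s' Js Js'.
have b1 t : J t -> `|(a * t - 1)^-1| <= c^-1.
  move=> /H Ht; have ? : 0 < - (a * t - 1) by lra.
  rewrite normfV ltr0_norm ?lef_pV2 ?posrE //; lra.
split; first by rewrite (le_trans (b1 _ Js)) // lerDl divr_ge0 // exprn_ge0 // ltW.
have -> : (a * s - 1)^-1 - (a * s' - 1)^-1
    = (a * s - 1)^-1 * (a * s' - 1)^-1 * (a * (s' - s)).
  by field; apply/andP; split; rewrite lt_eqF //; [have := H _ Js'|have := H _ Js]; lra.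
rewrite !normrM distrC mulrA.
apply: ler_wpM2r => //; apply: (@le_trans _ _ (c^-1 * c^-1 * `|a|)).
  by rewrite ler_wpM2r // ler_pM // b1.
by rewrite expr2 invfM mulrC lerDr invr_ge0 ltW.
Qed.

End bounded_lipschitz.

(** * The head of Kummer's series and the zeros in s *)
Section kummer_head.
Variables (R : realType) (l N : nat).
Implicit Types s x : R.
Let m := (l + N).+1.

(** [kummer_coef] divided by (2l+1)! prod_(j<N) ((l+1+j) s - 1), for k <= N. *)
Definition head_coef s k : R :=
  ((2 * l + 1 + k)`!%:R * k`!%:R)^-1 * \prod_(k <= j < N) ((l + 1 + j)%:R * s - 1)^-1.

(** The hypothesis (2m-1) s <= 2 is the right end of the window around 1/m; it
    keeps the divisors away from 0. *)
Lemma head_factor_lt s j : (j < N)%N -> (2 * m%:R - 1) * s <= 2 ->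
  (l + 1 + j)%:R * s - 1 <= - (2 * m%:R - 1)^-1.
Proof.
move=> jN s2; have m1 : 1 <= m%:R :> R by rewrite ler1n.
have m0 : 0 < 2 * m%:R - 1 :> R by lra.
rewrite -(ler_pM2r m0) mulNr mulVf ?gt_eqF //.
have a0 : 0 <= (l + 1 + j)%:R :> R by [].
have am : (l + 1 + j)%:R + 1 <= m%:R :> R by rewrite natr1 ler_nat /m; lia.
have := ler_wpM2l a0 s2.
by move: ((l + 1 + j)%:R) (m%:R) a0 am {s2} m1 m0 => a M a0 am m1 m0; lra.
Qed.

Lemma kummer_coef_head s k : (k <= N)%N -> (2 * m%:R - 1) * s <= 2 ->
  kummer_coef l s k
  = (2 * l + 1)`!%:R * \prod_(j < N) ((l + 1 + j)%:R * s - 1) * head_coef s k.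
Proof.
move=> kN s2; have m1 : 1 <= m%:R :> R by rewrite ler1n.
have m0 : 0 < (2 * m%:R - 1)^-1 :> R by rewrite invr_gt0; lra.
rewrite /kummer_coef /head_coef -!(big_mkord xpredT (fun j => (l + 1 + j)%:R * s - 1)).
rewrite (big_cat_nat (leq0n k) kN) /= prodfV.
have : \prod_(k <= j < N) ((l + 1 + j)%:R * s - 1) != 0.
  rewrite prodf_seq_neq0; apply/allP => j; rewrite mem_index_iota => /andP[_ jN].
  by rewrite lt_eqF // (le_lt_trans (head_factor_lt jN s2)) // oppr_lt0.
by move: (\prod_(k <= j < N) _) (_^-1) => P Q P0; field.
Qed.

(** With r = 1/x these are the terms of degree < N of the head divided by x^N;
    each carries at least one factor r. *)
Lemma head_rest_bound : exists2 L : R, 0 <= L & forall r s s' : R,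
  0 <= r <= 1 ->
  (2 * m%:R - 1) * s <= 2 -> (2 * m%:R - 1) * s' <= 2 ->
  `|\sum_(k < N) head_coef s k * r ^+ (N - k)| <= L * r /\
  `|\sum_(k < N) head_coef s k * r ^+ (N - k)
    - \sum_(k < N) head_coef s' k * r ^+ (N - k)| <= L * `|s - s'|.
Proof.
have m1 : 1 <= m%:R :> R by rewrite ler1n.
have m0 : 0 < (2 * m%:R - 1)^-1 :> R by rewrite invr_gt0; lra.
have BL k : bounded_lipschitz (fun s : R => (2 * m%:R - 1) * s <= 2) (head_coef^~ k).
  apply: bounded_lipschitzM; first exact: bounded_lipschitz_cst.
  pose K f := bounded_lipschitz (fun s : R => (2 * m%:R - 1) * s <= 2) f.
  have : forall r : seq nat, all (fun j => (j < N)%N) r ->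
      K (fun s => \prod_(j <- r) ((l + 1 + j)%:R * s - 1)^-1).
    elim=> [_|j r IH /= /andP[jN rN]].
      by under eq_fun do rewrite big_nil; exact: bounded_lipschitz_cst.
    under eq_fun do rewrite big_cons.
    apply: bounded_lipschitzM; last exact: IH.
    by apply: (bounded_lipschitz_inv m0) => s; exact: head_factor_lt.
  by move=> H; apply: H; apply/allP => j; rewrite mem_index_iota => /andP[].
suff : forall n, (n <= N)%N -> exists2 L : R, 0 <= L & forall r s s' : R,
  0 <= r <= 1 ->
  (2 * m%:R - 1) * s <= 2 -> (2 * m%:R - 1) * s' <= 2 ->
  `|\sum_(k < n) head_coef s k * r ^+ (N - k)| <= L * r /\
  `|\sum_(k < n) head_coef s k * r ^+ (N - k)
    - \sum_(k < n) head_coef s' k * r ^+ (N - k)| <= L * `|s - s'|.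
  by apply.
elim=> [_|n IH nN].
  by exists 0 => // r s s' _ _ _; rewrite !big_ord0 subrr normr0 !mul0r.
have [L L0 HL] := IH (ltnW nN); have [K K0 HK] := BL n.
exists (L + K) => [|r s s' r01 Js Js']; first exact: addr_ge0.
have [h1 h2] := HL r s s' r01 Js Js'; have [g1 g2] := HK s s' Js Js'.
case/andP: r01 => r0 r1.
rewrite !big_ord_recr /=.
move: (\sum_(_ < n) _) (\sum_(_ < n) _) h1 h2 => S' S h1 h2.
have rn0 : 0 <= r ^+ (N - n) by rewrite exprn_ge0.
have rn1 : r ^+ (N - n) <= r.
  by rewrite -(prednK (_ : 0 < N - n)%N) ?subn_gt0 // exprS ler_piMr ?exprn_ile1.
split.
  by rewrite (le_trans (ler_normD _ _)) // mulrDl lerD // normrM (ger0_norm rn0) ler_pM.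
rewrite (_ : _ - _ = (S - S') + (head_coef s n - head_coef s' n) * r ^+ (N - n)); last by ring.
rewrite (le_trans (ler_normD _ _)) // [leRHS]mulrDl lerD // normrM (ger0_norm rn0).
by rewrite -[leRHS]mulr1 ler_pM // (le_trans rn1).
Qed.

End kummer_head.

Section kummer_zero.
Variables (R : realType) (l N : nat).
Implicit Types s x : R.
Let m := (l + N).+1.

(** [head_coef] at k = N, the only one that does not depend on s. *)
Definition head_lead : R := ((m + l)`!%:R * N`!%:R)^-1.

(** The head without its factor x^N is balanced against the tail. *)
Lemma kummer_eq0 s x : 0 <= s -> 0 < x -> (2 * m%:R - 1) * s <= 2 ->
  kummer l s x = 0 <->
  head_lead + \sum_(k < N) head_coef l N s k * x^-1 ^+ (N - k)
  = (1 - m%:R * s) * (x * kummer_tail l N s x).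
Proof.
move=> s0 x0 s2; have m1 : 1 <= m%:R :> R by rewrite ler1n.
have m0 : 0 < (2 * m%:R - 1)^-1 :> R by rewrite invr_gt0; lra.
have P0 : \prod_(j < N) ((l + 1 + j)%:R * s - 1) != 0.
  apply/prodf_neq0 => j _.
  by rewrite lt_eqF // (le_lt_trans (head_factor_lt (ltn_ord j) s2)) // oppr_lt0.
set P := \prod_(j < N) _ in P0.
have F0 : (2 * l + 1)`!%:R != 0 :> R by rewrite pnatr_eq0 -lt0n fact_gt0.
have hN : head_coef l N s N = head_lead.
  rewrite /head_coef big_geq // mulr1 /head_lead.
  by rewrite (_ : (2 * l + 1 + N) = m + l)%N // /m; lia.
set e := \sum_(k < N) _.
have -> : kummer l s x = (2 * l + 1)`!%:R * P * x ^+ N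
    * (head_lead + e - (1 - m%:R * s) * (x * kummer_tail l N s x)).
  rewrite (kummer_split l N s0 (ltW x0)) big_ord_recr /= (kummer_coef_head (leqnn N)) // -/P hN.
  have -> : \sum_(i < N) kummer_coef l s i * x ^+ i = (2 * l + 1)`!%:R * P * x ^+ N * e.
    rewrite /e mulr_sumr; apply: eq_bigr => k _.
    rewrite (kummer_coef_head (ltnW (ltn_ord k))) // -/P.
    rewrite -[X in _ * x ^+ X * (_ * _)](subnKC (ltnW (ltn_ord k))).
    rewrite exprD exprVn.
    have : x ^+ (N - k) != 0 by rewrite expf_neq0 // gt_eqF.
    by move: (x ^+ (N - k)) (x ^+ k) => a b a0; field.
  by rewrite -/m exprS; ring.
split=> [/eqP|->]; last by rewrite subrr mulr0.
rewrite !mulf_eq0 (negPf F0) (negPf P0) (gt_eqF (exprn_gt0 N x0)) /=.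
by rewrite subr_eq0 => /eqP.
Qed.

(** The leading term of 1 - m s at the zero near 1/m: with r = x / m it is
    r^(2m) exp(- r) / (m (m+l)! N!). *)
Definition kummer_tau x : R :=
  (x / m%:R) ^+ (2 * m) * expR (- (x / m%:R)) / m%:R * head_lead.

(** [perturbed_zero] with t = x T.  On the window t is at least a multiple of
    x^3 ([fact2_sum_ge]), which for large x exceeds the multiples of x that it
    is compared with. *)
Lemma kummer_zero : exists2 X : R, 1 <= X & exists2 C : R, 0 <= C &
  forall x, X <= x -> exists s, [/\
    2 < (2 * m%:R + 1) * s /\ m%:R * s < 1,
    kummer l s x = 0,
    (forall s', 2 <= (2 * m%:R + 1) * s' -> (2 * m%:R - 1) * s' <= 2 ->
       kummer l s' x = 0 -> s' = s),
    `|(1 - m%:R * s) / kummer_tau x - 1| <= C / x &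
    1 - m%:R * s <= C / x].
Proof.
have mE2 : (N.+1 + (m + l).+1 = (2 * m).+1)%N by rewrite /m; lia.
have [L L0 HL] := head_rest_bound R l N; rewrite -/m in HL.
have [K2 K20 HK2] := fact2_sum_asymp R N.+1 (m + l).+1.
have [c cE] : exists c : R, c = head_lead by exists head_lead.
have c0 : 0 < c by rewrite cE /head_lead invr_gt0 mulr_gt0 // ltr0n fact_gt0.
have M0 : 0 < (2 * m + 1)%:R :> R by rewrite ltr0n addn1.
have [c2 c2E] : exists c2 : R,
  c2 = fact2_coef R N.+1 (m + l).+1 2 * 2 / (2 * m + 1)%:R ^+ 2 by eexists.
have c20 : 0 < c2 by rewrite c2E divr_gt0 ?exprn_gt0 // mulr_gt0 ?fact2_coef_gt0.
have [K KE] : exists K : R, K = (m.+1 * (2 * m + 1))%:R by eexists.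
have K0 : 0 <= K by rewrite KE.
have mE : (2 * m + 1)%:R = 2 * m%:R + 1 :> R by rewrite natrD natrM.
have m1 : 1 <= m%:R :> R by rewrite ler1n.
have m0 : 0 < m%:R :> R by rewrite ltr0n.
have cW := ltW c0; have c2W := ltW c20; have mW := ltW m0.
have [C1 C1E] : exists C1 : R, C1 = L / c + 6 * c * K / c2 by eexists.
have [C2 C2E] : exists C2 : R, C2 = K2 * m%:R by eexists.
have [D DE] : exists D : R, D = (2 * c * (2 * m%:R + 1) + L + 4 * c * K) / c2 by eexists.
have C10 : 0 <= C1 by rewrite C1E addr_ge0 // divr_ge0 // !mulr_ge0.
have C20 : 0 <= C2 by rewrite C2E mulr_ge0.
have D0 : 0 <= D.
  by rewrite DE divr_ge0 // !addr_ge0 // !mulr_ge0 // addr_ge0 // mulr_ge0.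
have Lc0 : 0 <= L / c by rewrite divr_ge0.
exists (1 + 2 * (L / c) + D + 2 * C2) => [|]; first by lra.
exists (2 * (C1 + C2) + 2 * c / c2).
  by rewrite addr_ge0 // ?divr_ge0 ?mulr_ge0 ?addr_ge0.
move=> x xX; have x1 : 1 <= x by lra.
have x0 : 0 < x by lra.
have sP s : 2 <= (2 * m%:R + 1) * s -> 0 <= s.
  move=> s2; rewrite leNgt; apply/negP => s0.
  have : (2 * m%:R + 1) * s <= 0 by rewrite pmulr_rle0 ?(ltW s0) // -mE.
  lra.
pose e s := \sum_(k < N) head_coef l N s k * x^-1 ^+ (N - k).
pose t s := x * kummer_tail l N s x.
have x01 : 0 <= x^-1 <= 1 by rewrite invr_ge0 (ltW x0) invf_le1.
have xx : x <= x ^+ 2 by rewrite expr2 ler_peMr // ltW.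
have xxx : x ^+ 2 <= x ^+ 3 by rewrite [leRHS]exprS ler_peMl // exprn_ge0 // ltW.
have Dx : 2 * c * (2 * m%:R + 1) + L + 4 * c * K <= c2 * (x - 1).
  by rewrite [leRHS]mulrC -ler_pdivrMr // -DE; lra.
have xW := ltW x0.
have cK0 : 0 <= c * K by rewrite mulr_ge0.
have cm0 : 0 <= c * m%:R by rewrite mulr_ge0.
have g1 : c2 * x <= c2 * x ^+ 2 by rewrite ler_wpM2l.
have g2 : c2 * x ^+ 2 <= c2 * x ^+ 3 by rewrite ler_wpM2l.
have g3 : c2 * x ^+ 3 <= m%:R * (c2 * x ^+ 3).
  by rewrite ler_peMl // mulr_ge0 ?exprn_ge0.
have g4 : (L + 4 * c * K) * x <= (c2 * (x - 1)) * x.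
  by apply: ler_wpM2r => //; lra.
have Lx : L <= L * x by rewrite ler_peMr.
have cKx : 0 <= c * K * x by rewrite mulr_ge0.
have c2x : 0 < c2 * x by rewrite mulr_gt0.
have Mx0 : 0 < c2 * x ^+ 3 by rewrite mulr_gt0 ?exprn_gt0.
have := @perturbed_zero R m%:R c L (c2 * x ^+ 3) (K * x) (L / x) e t m1 c0 Mx0
  (mulr_ge0 K0 xW).
case.
- by move=> s _ s2; have [+ _] := HL x^-1 s s x01 s2 s2.
- by move=> s s' _ s2 _ s2'; have [_] := HL x^-1 s s' x01 s2 s2'.
- move=> s s2; rewrite /t mulr_ge0 // kummer_tail_ge0 ?mE //; exact: sP.
- move=> s s2; rewrite /t exprSr mulrA [leRHS]mulrC ler_wpM2r //.
  have h : 2 <= (2 * m + 1)%:R * s by rewrite mE.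
  apply: le_trans (kummer_tail_ge (sP _ s2) xW h).
  apply: le_trans (fact2_sum_ge _ _ _); last by rewrite divr_ge0.
  by rewrite c2E expr_div_n -/m le_eqVlt; apply/orP; left; apply/eqP; ring.
- move=> s s' ss' h1 h2; have s0 := sP _ h1; rewrite -mE in h1.
  have /andP[q1 q2] := kummer_tail_lip xW s0 ss' h1 h2.
  rewrite /t -mulrBr mulr_ge0 //= [leRHS]mulrCA ler_wpM2l //.
  by rewrite KE mulrA.
- have hL : 2 * (L / c) <= x by lra.
  rewrite ler_pdivrMr //; have := ler_wpM2r cW hL.
  by rewrite -mulrA divfK ?gt_eqF //; lra.
- by lra.
- by lra.
- by lra.
move=> s [[sI1 sI2] Es us asy tle].
have s0 := sP s (ltW sI1).
have s2 : (2 * m%:R - 1) * s <= 2 by lra.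
have x20 : 0 < x ^+ 2 by rewrite exprn_gt0.
have c2x3 : (c2 * x ^+ 3)^-1 <= (c2 * x)^-1.
  by rewrite lef_pV2 ?posrE // exprS ler_wpM2l // ler_peMr //; lra.
exists s; split => //.
- by apply/kummer_eq0 => //; rewrite -cE.
- move=> s' h1 h2 z; apply: us => //; rewrite cE.
  by move: z => /kummer_eq0; apply => //; exact: sP.
- have u1 : `|(1 - m%:R * s) * t m%:R^-1 / c - 1| <= C1 / x.
    apply: (le_trans asy); rewrite C1E [leRHS]mulrDl lerD //; first by rewrite mulrAC.
    rewrite [leRHS](_ : _ = 6 * c * K * x * (c2 * x ^+ 2)^-1); last first.
      by field; rewrite !gt_eqF.
    rewrite mulrA ler_wpM2l //; first by rewrite !mulr_ge0.
    rewrite lef_pV2 ?posrE ?mulr_gt0 //; lra.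
  have r0 : 0 < x / m%:R by rewrite divr_gt0.
  pose g := fact2_sum N.+1 (m + l).+1 (x / m%:R) * (x / m%:R) ^+ (2 * m).+1 * expR (- (x / m%:R)).
  have gE : `|g - 1| <= C2 / x.
    have := HK2 _ r0; rewrite mE2.
    by rewrite C2E -/g => /le_trans; apply; rewrite invf_div mulrA.
  have tE : t m%:R^-1 = x * fact2_sum N.+1 (m + l).+1 (x / m%:R).
    by rewrite /t kummer_tail_eq // divff // gt_eqF.
  have g12 : C2 / x <= 1 / 2.
    by rewrite ler_pdivrMr //; move: xX Lc0 D0; clear; lra.
  have Gp : 0 < fact2_sum N.+1 (m + l).+1 (x / m%:R).
    apply: lt_le_trans (fact2_sum_ge _ _ (ltW r0)).
    by rewrite mulr_gt0 ?exprn_gt0 // mulr_gt0 // fact2_coef_gt0.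
  set u := (1 - m%:R * s) * t m%:R^-1 / c in u1.
  have -> : (1 - m%:R * s) / kummer_tau x = u / g.
    rewrite /u /g /kummer_tau -cE tE exprS.
    have G0 := lt0r_neq0 Gp.
    have : expR (- (x / m%:R)) != 0 by rewrite gt_eqF // expR_gt0.
    have : (x / m%:R) ^+ (2 * m) != 0 by rewrite expf_neq0 // gt_eqF.
    move: (expR _) (_ ^+ _) (fact2_sum _ _ _) G0 => a b G G0 b0 a0.
    by field; rewrite a0 b0 G0 !gt_eqF.
  apply: (le_trans (ratio_near1 u1 gE g12)).
  rewrite -mulrDl mulrA ler_wpM2r ?invr_ge0 // lerDl divr_ge0 // mulr_ge0 //.
- apply: (le_trans tle); rewrite [leRHS]mulrDl.
  apply: (@le_trans _ _ (2 * c / c2 / x)); last by rewrite lerDr divr_ge0 // mulr_ge0 // addr_ge0.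
  by rewrite -[leRHS]mulrA -invfM ler_wpM2l // mulr_ge0.
Qed.

End kummer_zero.

(** All coefficients are nonnegative, and the constant one is 1. *)
Lemma kummer_gt0 (R : realType) (l : nat) (s x : R) :
  0 <= x -> 1 <= (l + 1)%:R * s -> 0 < kummer l s x.
Proof.
move=> x0 s1; have s0 : 0 <= s.
  by rewrite -(pmulr_rge0 _ (_ : 0 < (l + 1)%:R)) ?ltr0n ?addn1 // (le_trans ler01) // -addn1.
have ck := exp_dominated_cvg (x := x) (kummer_coef_dominated l s0).
apply: lt_le_trans (lim_series_ge_term 0 ck _).
  rewrite /= expr0 mulr1 /kummer_coef big_ord0 mul1r divr_gt0 //.
move=> k /=; rewrite mulr_ge0 ?exprn_ge0 // mulr_ge0 //.
  apply: prodr_ge0 => j _; rewrite subr_ge0 (le_trans s1) // ler_wpM2r // ler_nat.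
  by rewrite leq_addr.
Qed.

(** * The radial equation and its regular solution *)

(** Derivation rules for functions given by their values, stated so that the
    derivative of an explicit formula can be written as a proof term. *)
Section pointwise_derivatives.
Variables (R : realType) (x : R).
Implicit Types (f g : R -> R) (a b : R).

Lemma derive_add f g a b : is_derive x 1 f a -> is_derive x 1 g b ->
  is_derive x 1 (fun t => f t + g t) (a + b).
Proof. by move=> fa gb; exact: is_deriveD. Qed.

Lemma derive_sub f g a b : is_derive x 1 f a -> is_derive x 1 g b ->
  is_derive x 1 (fun t => f t - g t) (a - b).
Proof. by move=> fa gb; exact: is_deriveB. Qed.

Lemma derive_mul f g a b : is_derive x 1 f a -> is_derive x 1 g b ->
  is_derive x 1 (fun t => f t * g t) (a * g x + f x * b).
Proof.
move=> fa gb; apply: (is_derive_eq (is_deriveM fa gb)).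
by rewrite /GRing.scale /= addrC [g x * a]mulrC.
Qed.

Lemma derive_const a : is_derive x 1 (fun=> a) 0.
Proof. exact: is_derive_cst. Qed.

Lemma derive_ident : is_derive x 1 (fun t => t) 1.
Proof. exact: is_derive_id. Qed.

Lemma derive_scale (k : R) f a : is_derive x 1 f a ->
  is_derive x 1 (fun t => k * f t) (k * a).
Proof.
by move=> fa; apply: (is_derive_eq (derive_mul (derive_const k) fa)); rewrite mul0r add0r.
Qed.

Lemma derive_comp f g a b : is_derive (g x) 1 f a -> is_derive x 1 g b ->
  is_derive x 1 (fun t => f (g t)) (a * b).
Proof. by move=> fa gb; exact: (is_derive1_comp fa gb). Qed.

Lemma derive_pow f a n : is_derive x 1 f a ->
  is_derive x 1 (fun t => f t ^+ n) (n%:R * f x ^+ n.-1 * a).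
Proof.
move=> fa; rewrite -[fun t => _]/(fun t => f t ^+ n) (_ : (fun t => f t ^+ n) = f ^+ n).
  exact: is_deriveX.
by apply/funext => t; rewrite exprfctE.
Qed.

Lemma derive_inv f a : f x != 0 -> is_derive x 1 f a ->
  is_derive x 1 (fun t => (f t)^-1) (- a / f x ^+ 2).
Proof.
move=> fx0 fa; apply: (is_derive_eq (is_deriveV fx0 fa)).
by rewrite /GRing.scale /= -exprVn; ring.
Qed.

End pointwise_derivatives.

(** u'' = V u on ]0, b[, with g = u'; the behaviour at 0 is left free, and
    continuity up to b allows evaluation there. *)
Definition solves (R : realType) (b : R) (V u g : R -> R) :=
  [/\ forall y : R, 0 < y < b -> is_derive y 1 u (g y),
      forall y : R, 0 < y < b -> is_derive y 1 g (V y * u y),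
      forall y : R, 0 < y < b -> {within `[y, b], continuous u}
    & forall y : R, 0 < y < b -> {within `[y, b], continuous g}].

(** Uniqueness for the Cauchy problem at b: (u^2 + g^2) exp((1 + C) t) is
    nondecreasing because 2 u g (1 + V) >= - (1 + C) (u^2 + g^2), and it vanishes
    at b. *)
Lemma solves_eq0 (R : realType) (b : R) (V u g : R -> R) (y C : R) :
  solves b V u g -> u b = 0 -> g b = 0 -> 0 < y < b ->
  (forall t, y < t < b -> `|V t| <= C) -> u y = 0.
Proof.
move=> [du dg cu cg] ub gb yb VC; have /andP[y0 yb1] := yb.
pose G t := (u t ^+ 2 + g t ^+ 2) * expR ((1 + C) * t).
pose dG t := (2 * u t * g t * (1 + V t) + (1 + C) * (u t ^+ 2 + g t ^+ 2))
  * expR ((1 + C) * t).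
have dGE t : t \in `]y, b[ -> is_derive t 1 G (dG t).
  rewrite in_itv /= => /andP[yt tb].
  have tb' : 0 < t < b by rewrite (lt_trans y0).
  have Du := du t tb'; have Dg := dg t tb'.
  apply: (is_derive_eq (derive_mul
    (derive_add (derive_pow 2 Du) (derive_pow 2 Dg))
    (derive_comp (is_derive_expR _) (derive_scale (1 + C) (derive_ident t))))).
  by rewrite /dG /= !expr1; ring.
have cG : {within `[y, b], continuous G}.
  have cu' := cu y yb; have cg' := cg y yb.
  move=> t; apply: cvgM.
    by apply: cvgD; apply: cvgM; [exact: cu'|exact: cu'|exact: cg'|exact: cg'].
  apply: (@continuous_subspaceT _ _ `[y, b] (fun t => expR ((1 + C) * t))).
  move=> z; apply: (continuous_comp (f := fun z => (1 + C) * z) (g := @expR R)).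
    exact: mulrl_continuous.
  exact: continuous_expR.
have [t tyb] := MVT yb1 dGE cG.
have {tyb} /VC : y < t < b by rewrite in_itv /= in tyb.
rewrite ler_norml => /andP[VC1 VC2].
have dG0 : 0 <= dG t.
  rewrite /dG mulr_ge0 ?expR_ge0 //; move: (u t) (g t) => p q.
  have p2 := sqr_ge0 p; have q2 := sqr_ge0 q.
  have [V1|/ltW V1] := leP 0 (1 + V t).
    rewrite [leRHS](_ : _ = (1 + V t) * (p + q) ^+ 2 + (C - V t) * (p ^+ 2 + q ^+ 2));
      last by ring.
    by apply: addr_ge0; apply: mulr_ge0; rewrite ?sqr_ge0 ?subr_ge0 //; lra.
  rewrite [leRHS](_ : _ = (- (1 + V t)) * (p - q) ^+ 2
    + (C + V t + 2) * (p ^+ 2 + q ^+ 2)); last by ring.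
  by apply: addr_ge0; apply: mulr_ge0; rewrite ?sqr_ge0 ?oppr_ge0 //; lra.
rewrite {1}/G ub gb !expr0n addr0 mul0r sub0r => E.
have : G y <= 0 by rewrite -oppr_ge0 E mulr_ge0 // subr_ge0 ltW.
rewrite /G pmulr_lle0 ?expR_gt0 // => H.
have : u y ^+ 2 <= 0 by apply: le_trans H; rewrite lerDl sqr_ge0.
by rewrite real_exprn_even_le0 ?num_real //= => /eqP.
Qed.

Lemma wronskian_const (R : realType) (b : R) (V u g p q : R -> R) (y : R) :
  solves b V u g -> solves b V p q -> 0 < y < b ->
  u y * q y - g y * p y = u b * q b - g b * p b.
Proof.
move=> [du dg cu cg] [dp dq cp cq] yb; have /andP[y0 yb1] := yb.
pose W t := u t * q t - g t * p t.
have dW t : t \in `]y, b[ -> is_derive t 1 W ((fun=> 0) t).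
  rewrite in_itv /= => /andP[yt tb].
  have tb' : 0 < t < b by rewrite (lt_trans y0).
  have H := derive_sub (derive_mul (du t tb') (dq t tb')) (derive_mul (dg t tb') (dp t tb')).
  by apply: (is_derive_eq H); ring.
have cW : {within `[y, b], continuous W}.
  have cu' := cu y yb; have cg' := cg y yb; have cp' := cp y yb; have cq' := cq y yb.
  by move=> t; apply: cvgB; apply: cvgM; [exact: cu'|exact: cq'|exact: cg'|exact: cp'].
have [t _] := MVT yb1 dW cW; rewrite mul0r => /eqP.
by rewrite subr_eq0 => /eqP.
Qed.

(** The quotient w = u / p has derivative - w0 / p^2, of constant sign and of
    order y^(-2l-2).  Hence w(2 y) - w(y) is at least of order y^(-2l-1), while
    w(2 y) stays on one side of a fixed value; so w itself is at least of order
    y^(-2l-1), and u = w p of order y^(-l). *)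
Lemma singular_growth (R : realType) (u g p q : R -> R) (a k K w0 : R) (l : nat) :
  0 < a -> 0 < k -> w0 != 0 ->
  (forall y : R, 0 < y < a -> is_derive y 1 u (g y)) ->
  (forall y : R, 0 < y < a -> is_derive y 1 p (q y)) ->
  (forall y : R, 0 < y < a -> k * y ^+ l.+1 <= p y <= K * y ^+ l.+1) ->
  (forall y : R, 0 < y < a -> u y * q y - g y * p y = w0) ->
  exists c y1 : R, [/\ 0 < c, 0 < y1 & forall y : R, 0 < y < y1 -> c <= `|u y| * y ^+ l].
Proof.
move=> a0 k0 w00 du dp pB Wc.
(* replacing u by - u changes the sign of the Wronskian *)
wlog wn : u g w0 w00 du Wc / w0 < 0 => [H|].
  have [w0p|w0n|] := ltgtP w0 0; first exact: (H u g w0).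
    have := H (fun y => - u y) (fun y => - g y) (- w0).
    rewrite oppr_eq0 oppr_lt0 => /(_ w00 _ _ w0n) [||c [y1 [c0 y10 cy]]].
    - by move=> y yb; exact: is_deriveN (du y yb).
    - by move=> y yb; rewrite -(Wc y yb); ring.
    exists c, y1; split => // y yb; have := cy y yb.
    by rewrite normrN.
  by move/eqP; rewrite (negPf w00).
pose w t := u t / p t.
have p0 y : 0 < y < a -> 0 < p y.
  move=> yb; have /andP[+ _] := pB y yb; apply: lt_le_trans.
  by rewrite mulr_gt0 ?exprn_gt0 //; case/andP: yb.
have dw y : 0 < y < a -> is_derive y 1 w (- w0 / p y ^+ 2).
  move=> yb; have py := p0 y yb; have pn : p y != 0 by rewrite gt_eqF.
  apply: (is_derive_eq (derive_mul (du y yb) (derive_inv pn (dp y yb)))).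
  by rewrite -(Wc y yb); field.
have K0 : 0 < K.
  have h : 0 < a / 2 < a by rewrite divr_gt0 //=; lra.
  have /andP[_ hK] := pB _ h; have := lt_le_trans (p0 _ h) hK.
  by rewrite pmulr_lgt0 // exprn_gt0 // divr_gt0.
have mvt y z : 0 < y -> y < z -> z < a ->
    exists2 t, y < t < z & w z - w y = - w0 / p t ^+ 2 * (z - y).
  move=> y0 yz za.
  have yza t : t \in `[y, z] -> 0 < t < a.
    by rewrite in_itv /= => /andP[h1 h2]; rewrite (lt_le_trans y0 h1) (le_lt_trans h2 za).
  have [||t tb E] := @MVT R w (fun t => - w0 / p t ^+ 2) y z yz.
  - move=> t tb; apply: dw; apply: yza.
    by move: tb; rewrite !in_itv /= => /andP[/ltW -> /ltW ->].
  - apply: derivable_within_continuous => t /yza /dw H.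
    by case: H.
  - by move: tb; rewrite in_itv /=; exists t.
(* on [y, 2y], p^2 <= K^2 (2y)^(2l+2) *)
have [D DE] : exists D : R, D = - w0 / (K ^+ 2 * 2 ^+ (2 * l.+1)) by eexists.
have D0 : 0 < D by rewrite DE divr_gt0 ?oppr_gt0 // mulr_gt0 ?exprn_gt0.
have step y : 0 < y -> 2 * y < a -> D / y ^+ (2 * l.+1).-1 <= w (2 * y) - w y.
  move=> y0 ya; have [|t /andP[yt ty] ->] := mvt y (2 * y) y0 _ ya; first lra.
  have tb : 0 < t < a by rewrite (lt_trans y0 yt) (lt_trans ty ya).
  have /andP[_ h] := pB t tb; have pt := p0 t tb.
  have h2 : p t ^+ 2 <= K ^+ 2 * 2 ^+ (2 * l.+1) * y ^+ (2 * l.+1).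
    rewrite -mulrA -exprMn mulnC exprM -exprMn.
    rewrite lerXn2r ?nnegrE ?(ltW pt) //.
      by rewrite mulr_ge0 ?exprn_ge0 ?mulr_ge0 // ltW.
    apply: (le_trans h); rewrite ler_wpM2l ?(ltW K0) //.
    by rewrite lerXn2r ?nnegrE ?(ltW ty) ?mulr_ge0 // ltW // (lt_trans y0).
  rewrite [_ - y](_ : _ = y); last by ring.
  have yn : y != 0 by rewrite gt_eqF.
  have -> : D / y ^+ (2 * l.+1).-1 = D / y ^+ (2 * l.+1) * y.
    rewrite -{2}(prednK (_ : 0 < 2 * l.+1)%N) // exprS; field.
    by rewrite yn expf_neq0.
  rewrite ler_wpM2r ?(ltW y0) // DE -mulrA -invfM.
  by rewrite ler_wpM2l ?oppr_ge0 ?(ltW wn) // lef_pV2 ?posrE ?mulr_gt0 ?exprn_gt0.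
pose y0 := a / 2; have y00 : 0 < y0 by rewrite divr_gt0.
(* below y1, the fixed value w(y0) is at most half of D / y^(2l+1) *)
pose y1 := Num.min (y0 / 2) (Num.min 1 (D / (2 * (`|w y0| + 1)))).
have wy0 : 0 < `|w y0| + 1 by rewrite ltr_wpDl.
exists (D / 2 * k), y1; split.
- by rewrite mulr_gt0 // divr_gt0.
- rewrite !lt_min ltr01 andTb; apply/andP.
  by split; apply: divr_gt0 => //; exact: mulr_gt0.
move=> y /andP[yp]; rewrite !lt_min => /and3P[yy0 yl1 yw].
have ya : y < a by rewrite /y0 in yy0; lra.
have yb : 0 < y < a by rewrite yp.
have w2 : w (2 * y) <= w y0.
  have [|e|<-] := ltgtP (2 * y) y0; last by [].
    move=> lt2; have [||t /andP[t1 t2] E] := mvt (2 * y) y0 _ lt2; rewrite ?mulr_gt0 //.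
      by rewrite /y0; lra.
    rewrite -subr_ge0 E mulr_ge0 ?subr_ge0 ?(ltW lt2) // divr_ge0 ?sqr_ge0 //.
    by rewrite oppr_ge0 ltW.
  by move: e yy0; rewrite /y0; lra.
have {}w2 : w y <= w y0 - D / y ^+ (2 * l.+1).-1.
  by have := step y yp; rewrite /y0 in yy0 w2 *; move=> /(_ _); lra.
have yM : 0 < y ^+ (2 * l.+1).-1 by rewrite exprn_gt0.
have w3 : w y0 <= D / 2 / y ^+ (2 * l.+1).-1.
  rewrite ler_pdivlMr //; apply: (@le_trans _ _ ((`|w y0| + 1) * y)).
    apply: (@le_trans _ _ ((`|w y0| + 1) * y ^+ (2 * l.+1).-1)).
      by rewrite ler_wpM2r ?(ltW yM) // (le_trans (ler_norm _)) // lerDl.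
    rewrite ler_wpM2l ?(ltW wy0) // mulnS /= exprS ler_piMr ?(ltW yp) //.
    by rewrite exprn_ile1 // ltW.
  have /ltW := yw; rewrite ler_pdivlMr ?mulr_gt0 // => h.
  by rewrite ler_pdivlMr //; move: h; lra.
have py := p0 y yb; have /andP[pk _] := pB y yb.
have -> : u y = w y * p y by rewrite /w divfK // gt_eqF.
have {}w3 : w y <= - (D / 2 / y ^+ (2 * l.+1).-1).
  have : D / 2 / y ^+ (2 * l.+1).-1 = D / y ^+ (2 * l.+1).-1 / 2 by ring.
  by move=> E; rewrite E in w3 *; lra.
rewrite normrM (gtr0_norm py).
have {w3} : D / 2 / y ^+ (2 * l.+1).-1 <= `|w y|.
  by rewrite -normrN (le_trans _ (ler_norm _)) //; lra.
move=> w3; apply: (@le_trans _ _ (D / 2 / y ^+ (2 * l.+1).-1 * (k * y ^+ l.+1) * y ^+ l)).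
  have -> : ((2 * l.+1).-1 = l.+1 + l)%N by rewrite mul2n -addnn addnS.
  have A0 : y ^+ l.+1 != 0 by rewrite expf_neq0 // gt_eqF.
  have B0 : y ^+ l != 0 by rewrite expf_neq0 // gt_eqF.
  rewrite (exprD y l.+1 l) le_eqVlt; apply/orP; left; apply/eqP.
  by move: (y ^+ l.+1) (y ^+ l) A0 B0 => A B A0 B0; field; rewrite A0 B0.
rewrite ler_wpM2r ?exprn_ge0 ?(ltW yp) //.
apply: ler_pM => //; first by rewrite ltW // !divr_gt0.
by rewrite ltW // mulr_gt0 // exprn_gt0.
Qed.

Section regular_solution.
Variables (R : realType) (l : nat) (c s : R).
Hypotheses (c_gt0 : 0 < c) (s_gt0 : 0 < s).

(** The eigenvalue equation is u'' = coulomb_pot u for c = Z / h^2 and the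
    energy - Z^2 s^2 / (4 h^2). *)
Definition coulomb_pot (y : R) : R :=
  (l * l.+1)%:R / y ^+ 2 - c / y + (c * s) ^+ 2 / 4.

Definition regular_sol (y : R) : R :=
  (c * y) ^+ l.+1 * expR (- (s / 2) * (c * y)) * kummer l s (c * y).

(** The derivative of [regular_sol] on the positive half-line; the power l is
    written as (l+1) minus 1 to avoid a case distinction on l = 0. *)
Definition regular_der (y : R) : R :=
  c * ((c * y) ^+ l.+1 * expR (- (s / 2) * (c * y))
   * (l.+1%:R * (c * y)^-1 * kummer l s (c * y) - s / 2 * kummer l s (c * y)
      + kummer1 l s (c * y))).

Lemma is_derive_regular_sol (y : R) : 0 < y ->
  is_derive y 1 regular_sol (regular_der y).
Proof.
move=> y0; have x0 : c * y != 0 by rewrite gt_eqF // mulr_gt0.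
have Dx : is_derive y 1 (fun t => c * t) (c * 1) := derive_scale c (derive_ident y).
have Dk := derive_comp (is_derive_kummer l (c * y) (ltW s_gt0)) Dx.
have De := derive_comp (is_derive_expR _) (derive_scale (- (s / 2)) Dx).
apply: (is_derive_eq (derive_mul (derive_mul (derive_pow l.+1 Dx) De) Dk)).
rewrite /regular_der -[l.+1.-1]/l; move: (c * y) x0 => x x0 {Dx Dk De}.
move: (kummer _ _ _) (kummer1 _ _ _) (expR _) => F0 F1 E.
by rewrite exprS; move: (x ^+ l) (l.+1%:R) => P L; field.
Qed.

Lemma is_derive_regular_der (y : R) : 0 < y ->
  is_derive y 1 regular_der (coulomb_pot y * regular_sol y).
Proof.
move=> y0; have x0 : c * y != 0 by rewrite gt_eqF // mulr_gt0.
have Dx : is_derive y 1 (fun t => c * t) (c * 1) := derive_scale c (derive_ident y).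
have Dk := derive_comp (is_derive_kummer l (c * y) (ltW s_gt0)) Dx.
have Dk1 := derive_comp (is_derive_kummer1 l (c * y) (ltW s_gt0)) Dx.
have De := derive_comp (is_derive_expR _) (derive_scale (- (s / 2)) Dx).
have Di := derive_inv x0 Dx.
have H := derive_scale c (derive_mul (derive_mul (derive_pow l.+1 Dx) De)
  (derive_add (derive_sub (derive_mul (derive_scale l.+1%:R Di) Dk)
    (derive_scale (s / 2) Dk)) Dk1)).
apply: (is_derive_eq H).
have := kummer_ode l (c * y) (ltW s_gt0).
have -> : coulomb_pot y * regular_sol y
    = c ^+ 2 * ((l * l.+1)%:R / (c * y) ^+ 2 - (c * y)^-1 + s ^+ 2 / 4) * regular_sol y.
  by congr (_ * _); rewrite /coulomb_pot; field; rewrite !gt_eqF.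
rewrite /regular_sol -[l.+1.-1]/l; move: (c * y) x0 => x x0 {Dx Dk Dk1 De Di H}.
move: (kummer _ _ _) (kummer1 _ _ _) (kummer2 _ _ _) (expR _) => F0 F1 F2 E ode.
have -> : F2 = - (((2 * l + 2)%:R - s * x) * F1 + (1 - (l + 1)%:R * s) * F0) / x.
  apply: (mulIf x0); rewrite divfK //.
  by apply/eqP; rewrite -subr_eq0 -ode; apply/eqP; ring.
rewrite natrD !natrM -natr1 [(l + 1)%:R]natrD exprS.
by move: (x ^+ l) (l%:R) => P L; field.
Qed.

Lemma continuous_regular_sol : continuous regular_sol.
Proof.
move=> y.
have Dx : is_derive y 1 (fun t => c * t) (c * 1) := derive_scale c (derive_ident y).
have Dk := derive_comp (is_derive_kummer l (c * y) (ltW s_gt0)) Dx.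
have De := derive_comp (is_derive_expR _) (derive_scale (- (s / 2)) Dx).
have [H _] := derive_mul (derive_mul (derive_pow l.+1 Dx) De) Dk.
exact/differentiable_continuous/derivable1_diffP.
Qed.

Lemma regular_sol0 : regular_sol 0 = 0.
Proof. by rewrite /regular_sol mulr0 exprS !mul0r. Qed.

Lemma regular_sol_eq0 (y : R) : 0 < y ->
  regular_sol y = 0 <-> kummer l s (c * y) = 0.
Proof.
move=> y0; rewrite /regular_sol; split=> [/eqP|->]; last by rewrite mulr0.
rewrite !mulf_eq0 expf_eq0 /= mulf_eq0 (gt_eqF c_gt0) (gt_eqF y0).
by rewrite (gt_eqF (expR_gt0 _)) => /eqP.
Qed.

Lemma regular_sol_solves (b : R) :
  solves b coulomb_pot regular_sol regular_der.
Proof.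
have itv (y t : R) : 0 < y < b -> t \in `[y, b] -> 0 < t.
  by move=> /andP[y0 _]; rewrite in_itv /= => /andP[+ _]; exact: lt_le_trans.
split=> y yb.
- by apply: is_derive_regular_sol; case/andP: yb.
- by apply: is_derive_regular_der; case/andP: yb.
- apply: derivable_within_continuous => t /(itv _ _ yb) t0.
  by case: (is_derive_regular_sol t0).
- apply: derivable_within_continuous => t /(itv _ _ yb) t0.
  by case: (is_derive_regular_der t0).
Qed.

Lemma regular_sol_near0 : exists a k K : R, [/\ 0 < a, 0 < k &
  forall y, 0 < y < a -> k * y ^+ l.+1 <= regular_sol y <= K * y ^+ l.+1].
Proof.
pose f (y : R) := expR (- (s / 2) * (c * y)) * kummer l s (c * y).
have f0 : f 0 = 1 by rewrite /f !mulr0 expR0 kummer0 mulr1.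
have cf : {for 0, continuous f}.
  have Dx : is_derive (0 : R) 1 (fun t : R => c * t) (c * 1) :=
    derive_scale c (derive_ident 0).
  have Dk := derive_comp (is_derive_kummer l (c * 0) (ltW s_gt0)) Dx.
  have De := derive_comp (is_derive_expR _) (derive_scale (- (s / 2)) Dx).
  have [H _] := derive_mul De Dk.
  exact/differentiable_continuous/derivable1_diffP.
have h2 : 0 < 1 / 2 :> R by lra.
have H := (@cvgrPdist_lt _ _ _ _ _ f (f 0)).1 cf (1 / 2) h2.
have [a /= a0 Ha] := (nbhs_ballP _ _).1 (H _).
exists a, (1 / 2 * c ^+ l.+1), (2 * c ^+ l.+1); split => //.
  by rewrite mulr_gt0 ?exprn_gt0.
move=> y /andP[y0 ya].
have := Ha y; rewrite /ball /= sub0r normrN gtr0_norm // => /(_ ya).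
rewrite f0 ltr_distlC => /andP[f1 f2].
have -> : regular_sol y = f y * (c ^+ l.+1 * y ^+ l.+1).
  by rewrite /regular_sol /f exprMn; ring.
have P0 : 0 <= c ^+ l.+1 * y ^+ l.+1 by rewrite mulr_ge0 ?exprn_ge0 // ltW.
rewrite -[1 / 2 * _ * _]mulrA -[2 * _ * _]mulrA.
by apply/andP; split; apply: ler_wpM2r => //; lra.
Qed.

(** If g(b) = 0 then u vanishes by [solves_eq0].  Otherwise the Wronskian of u
    and the regular solution, constant and equal to - g(b) regular_sol(b), is
    nonzero, and u has the growth that is excluded. *)
Lemma dirichlet_regular (b : R) (u g : R -> R) : 0 < b ->
  solves b coulomb_pot u g -> u b = 0 -> regular_sol b != 0 ->
  (forall c0 y1 : R, 0 < c0 -> 0 < y1 ->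
     ~ (forall y, 0 < y < y1 -> c0 <= `|u y| * y ^+ l)) ->
  forall y, 0 < y < b -> u y = 0.
Proof.
move=> b0 su ub pb nsing y yb; have /andP[y0 yb1] := yb.
have [gb|gb] := eqVneq (g b) 0.
  apply: (solves_eq0 (C := (l * l.+1)%:R / y ^+ 2 + c / y + (c * s) ^+ 2 / 4)
    su ub gb yb) => t /andP[yt tb].
  have t0 := lt_trans y0 yt.
  have i1 : t^-1 <= y^-1 by rewrite lef_pV2 ?posrE // ltW.
  rewrite /coulomb_pot (le_trans (ler_normD _ _)) // lerD //; last first.
    by rewrite ger0_norm // divr_ge0 ?sqr_ge0.
  rewrite (le_trans (ler_normB _ _)) // lerD //.
    rewrite ger0_norm ?divr_ge0 ?exprn_ge0 ?(ltW t0) // ler_wpM2l //.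
    by rewrite lef_pV2 ?posrE ?exprn_gt0 // lerXn2r ?nnegrE ?ltW.
  by rewrite ger0_norm ?divr_ge0 ?(ltW t0) ?(ltW c_gt0) // ler_wpM2l // ltW.
have [a [k [K [a0 k0 pB]]]] := regular_sol_near0.
have [du _ _ _] := su.
pose a' := Num.min a b.
have a'0 : 0 < a' by rewrite lt_min a0.
have sub t : 0 < t < a' -> 0 < t < a /\ 0 < t < b.
  by rewrite lt_min => /and3P[-> -> ->].
have w0 : u b * regular_der b - g b * regular_sol b != 0.
  by rewrite ub mul0r sub0r oppr_eq0 mulf_neq0.
have [||||c0 [y1 [c00 y10 H]]] := @singular_growth R u g regular_sol regular_der
    a' k K _ l a'0 k0 w0.
- by move=> t /sub[_ tb]; exact: du.
- by move=> t /sub[_ /andP[t0 _]]; exact: is_derive_regular_sol.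
- by move=> t /sub[ta _]; exact: pB.
- by move=> t /sub[_ tb]; apply: wronskian_const tb; [exact: su|exact: regular_sol_solves].
by case: (nsing c0 y1 c00 y10 H).
Qed.

End regular_solution.

(** * Absolutely continuous and square-integrable functions *)

Section absolute_continuity.
Variables (R : realType) (b : R).
Implicit Types (f g k : R -> R).

Lemma ac_increment f g (y t : R) : ac_deriv b f g -> 0 < y -> y <= t <= b ->
  f t = f y + \int[lebesgue_measure]_(x in `[y, t]) g x.
Proof.
move=> fg y0 /andP[yt tb].
have [iy Ey] := fg y (introT andP (conj y0 (le_trans yt tb))).
have [it Et] := fg t (introT andP (conj (lt_le_trans y0 yt) tb)).
have := @Rintegral_itvB R g (BLeft y) (BRight b) t iy.
rewrite !bnd_simp => /(_ yt tb).
rewrite Rintegral_itv_obnd_cbnd => [|]; last first.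
  apply: integrableS it => //; exact: subset_itv_oc_cc.
by rewrite -Ey -Et; lra.
Qed.

Lemma ac_continuous f g (y : R) : ac_deriv b f g -> 0 < y < b ->
  {within `[y, b], continuous f}.
Proof.
move=> fg /andP[y0 yb].
have [iy _] := fg y (introT andP (conj y0 (ltW yb))).
have H := parameterized_integral_continuous (ltW yb) iy.
apply: (@subspace_eq_continuous _ _ _
  (fun x => f y + parameterized_integral lebesgue_measure y x g)).
  move=> x; rewrite inE /= in_itv /= => /andP[yx xb].
  by apply/esym; apply: (ac_increment fg y0); rewrite yx.
by move=> x; apply: cvgD; [exact: cvg_cst|exact: H].
Qed.

(** An a.e. derivative that agrees a.e. with a continuous function is a
    derivative everywhere: this upgrades the operator's domain to classical
    solutions. *)
Lemma ac_is_derive f g k (y : R) : ac_deriv b f g ->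
  {ae lebesgue_measure, forall t : R, 0 < t < b -> g t = k t} ->
  (forall t : R, 0 < t < b -> {for t, continuous k}) ->
  0 < y < b -> is_derive y 1 f (k y).
Proof.
move=> fg gk ck /andP[y0 yb].
pose a := y / 2; pose c := (y + b) / 2.
have a0 : 0 < a by rewrite divr_gt0.
have ay : a < y by rewrite /a; lra.
have yc : y < c by rewrite /c; lra.
have cb : c < b by rewrite /c; lra.
have kc : {within `[a, c], continuous k}.
  apply: continuous_in_subspaceT => t; rewrite inE /= in_itv /= => /andP[at_ tc].
  by apply: ck; rewrite (lt_le_trans a0) ?(le_lt_trans tc).
have ki : lebesgue_measure.-integrable `[a, c] (EFin \o k).
  by apply: continuous_compact_integrable => //; exact: segment_compact.
have [ia _] := fg a (introT andP (conj a0 (ltW (lt_trans ay yb)))).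
have [dF F'] := @continuous_FTC1_closed R k a y c yc ki ay (ck y (introT andP (conj y0 yb))).
set F := (fun x : R => _) in dF F'.
have E : \near y, (fun x => f a + F x) y = f y.
  near=> x.
  have xac : a <= x <= c.
    by apply/andP; split; apply/ltW; near: x; [exact: lt_nbhsr|exact: lt_nbhsl].
  have /andP[ax xc] := xac.
  rewrite (ac_increment fg a0 (y := a) (t := x)); last by rewrite ax (le_trans xc) // ltW.
  congr (_ + _); rewrite /F /Rintegral; congr fine.
  apply: ae_eq_integral => //.
  - have : lebesgue_measure.-integrable `[a, x] (EFin \o k).
      by apply: integrableS ki => //; apply: subset_itvl; rewrite bnd_simp.
    by case/integrableP.
  - have : lebesgue_measure.-integrable `[a, x] (EFin \o g).
      apply: integrableS ia => //; apply: subset_itvl; rewrite bnd_simp.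
      by rewrite (le_trans xc) // ltW.
    by case/integrableP.
  - apply: (@filterS _ _ (ae_filter_ringOfSetsType lebesgue_measure) _ _ _ gk) => t Ht.
    rewrite /= in_itv /= => /andP[at_ tx].
    by rewrite Ht // (lt_le_trans a0) // (le_lt_trans tx) // (le_lt_trans xc).
apply: (near_eq_is_derive E).
have H : is_derive y 1 F (k y).
  by split; [exact: dF|rewrite -derive1E; exact: F'].
by apply: (is_derive_eq (derive_add (derive_const _ (f a)) H)); rewrite add0r.
Unshelve. all: by end_near. Qed.

Lemma C1_ac_deriv f g :
  (forall y : R, 0 < y -> is_derive y 1 f (g y)) ->
  (forall y : R, 0 < y -> {for y, continuous g}) -> ac_deriv b f g.
Proof.
move=> df cg y /andP[y0 yb].
have cf t : 0 < t -> {for t, continuous f}.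
  move=> /df [H _]; exact/differentiable_continuous/derivable1_diffP.
have gc : {within `[y, b], continuous g}.
  apply: continuous_in_subspaceT => t; rewrite inE /= in_itv /= => /andP[yt _].
  by apply: cg; exact: lt_le_trans yt.
have gi : lebesgue_measure.-integrable `[y, b] (EFin \o g).
  by apply: continuous_compact_integrable => //; exact: segment_compact.
split => //; move: yb; rewrite le_eqVlt => /predU1P[<-|yb].
  by rewrite set_itv1 Rintegral_set1 subrr.
have b0 := lt_trans y0 yb.
rewrite /Rintegral (@continuous_FTC2 R g f y b) //.
- split.
  + move=> t; rewrite in_itv /= => /andP[yt _].
    by case: (df t (lt_trans y0 yt)).
  + by apply: cvg_at_right_filter; exact: cf.
  + by apply: cvg_at_left_filter; exact: cf.
- move=> t; rewrite in_itv /= => /andP[yt _].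
  have [d1 d2] := df t (lt_trans y0 yt).
  by rewrite derive1E d2.
Qed.

End absolute_continuity.

Section square_integrability.
Variables (R : realType) (b : R).
Local Notation mu := (@lebesgue_measure R).

Lemma L2_continuous (f : R -> R) : continuous f ->
  (f \_ `]0, b[ : R -> R) \in Lfun mu 2%:E.
Proof.
move=> cf; rewrite inE; apply/andP; split; rewrite inE /=.
  apply/(measurable_restrictT f) => //.
  apply: subspace_continuous_measurable_fun => //; exact: continuous_subspaceT.
rewrite /finite_norm unlock poweR_lty //.
have ci : mu.-integrable `[0, b] (EFin \o (fun x => f x ^+ 2)).
  apply: continuous_compact_integrable; first exact: segment_compact.
  apply: continuous_subspaceT => x; apply: continuousM; exact: cf.
have /integrableP[_] : mu.-integrable `]0, b[ (EFin \o (fun x => f x ^+ 2)).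
  apply: integrableS ci => //; exact: subset_itv_oo_cc.
rewrite [X in (X < _)%E -> _]integral_mkcond; apply: le_lt_trans.
rewrite le_eqVlt; apply/orP; left; apply/eqP; apply: eq_integral => x _ /=.
rewrite !patchE; case: ifPn => _ /=.
  by rewrite powR_mulrn // normrX.
by rewrite normr0 powR0 // pnatr_eq0.
Qed.

(** On [e, 2e] the bound gives u^2 >= c0^2 / (2e)^2, so the integral of u^2 is
    at least c0^2 / (4e) for every small e. *)
Lemma L2_not_singular (u : R -> R) (l : nat) (c0 y1 : R) : 0 < b -> (0 < l)%N ->
  (u \_ `]0, b[ : R -> R) \in Lfun mu 2%:E -> 0 < c0 -> 0 < y1 ->
  ~ (forall y : R, 0 < y < y1 -> c0 <= `|u y| * y ^+ l).
Proof.
move=> b0 l0 /Lfun2_integrable_sqr ui c00 y10 H.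
have /integrableP[um] := ui.
set I := (X in (X < _)%E) => Ioo.
have [r rE] : exists r : R, I = r%:E.
  exists (fine I); rewrite fineK // ge0_fin_numE //; exact: integral_ge0.
have r0 : 0 <= r by rewrite -lee_fin -rE; exact: integral_ge0.
(* the last bound makes c0^2 / (4e) exceed the integral r *)
pose e := Num.min (Num.min (y1 / 4) (b / 4)) (Num.min (1 / 4) (c0 ^+ 2 / (8 * (r + 1)))).
have r1 : 0 < r + 1 by rewrite ltr_wpDl.
have e0 : 0 < e.
  rewrite !lt_min; apply/andP; split; apply/andP; split; apply: divr_gt0 => //.
    by rewrite exprn_gt0.
  by rewrite mulr_gt0.
have ey1 : e <= y1 / 4 by rewrite !ge_min lexx.
have eb : e <= b / 4 by rewrite !ge_min lexx orbT.
have e1 : e <= 1 / 4 by rewrite !ge_min lexx !orbT.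
have er : e <= c0 ^+ 2 / (8 * (r + 1)) by rewrite !ge_min lexx !orbT.
clearbody e.
pose d := (c0 / (2 * e)) ^+ 2.
pose S : set R := `[e, 2 * e]%classic.
pose F (x : R) : R := (u \_ `]0, b[ : R -> R) x ^+ 2.
have mS : mu S = e%:E.
  rewrite /S lebesgue_measure_itv /= lte_fin ifT; last by lra.
  by rewrite -EFinD; congr (_%:E); ring.
have lo1 : ((d * e)%:E <= \int[mu]_(x in S) (cst d%:E x))%E.
  have -> : (\int[mu]_(x in S) (cst d%:E x) = d%:E * mu S)%E.
    by apply: integral_cst; exact: measurable_itv.
  by rewrite mS -EFinM.
have lo2 : (\int[mu]_(x in S) (cst d%:E x) <= \int[mu]_(x in S)
      `|(EFin \o F) x|)%E.
  apply: ge0_le_integral => //.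
  - exact: measurable_itv.
  - by move=> x _; rewrite lee_fin sqr_ge0.
  - apply: measurable_funTS; exact: measurableT_comp.
  move=> x; rewrite /S /= in_itv /= => /andP[ex xe].
  have x0 : 0 < x := lt_le_trans e0 ex.
  rewrite /F patchE ifT; last by rewrite inE /= in_itv /= x0; lra.
  rewrite lee_fin ger0_norm ?sqr_ge0 // -[leRHS]real_normK ?num_real //.
  rewrite lerXn2r ?nnegrE ?divr_ge0 ?(ltW c00) ?mulr_ge0 ?(ltW e0) //.
  rewrite ler_pdivrMr ?mulr_gt0 //.
  have hx : c0 <= `|u x| * x ^+ l by apply: H; rewrite x0; lra.
  apply: (le_trans hx); apply: ler_wpM2l => //.
  have x1 : x <= 1 by lra.
  apply: le_trans xe; rewrite -(prednK l0) exprS ler_piMr ?(ltW x0) //.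
  by rewrite exprn_ile1 ?(ltW x0).
have lo3 : (\int[mu]_(x in S)
      `|(EFin \o F) x| <= I)%E.
  apply: ge0_subset_integral => //; first exact: measurable_itv.
  exact: measurableT_comp.
have lo := le_trans lo1 (le_trans lo2 lo3).
move: lo; rewrite rE lee_fin leNgt => /negP; apply.
have -> : d * e = c0 ^+ 2 / (4 * e) by rewrite /d; field; rewrite gt_eqF.
rewrite ltr_pdivlMr ?mulr_gt0 //.
move: er; rewrite ler_pdivlMr ?mulr_gt0 // => er.
have : 0 <= r * e by rewrite mulr_ge0 // ltW.
lra.
Qed.

End square_integrability.

(** * Eigenvalues as zeros of Kummer's function *)

Lemma continuous_interior (R : realType) (b : R) (f : R -> R) :
  (forall y : R, 0 < y < b -> {within `[y, b], continuous f}) ->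
  forall t : R, 0 < t < b -> {for t, continuous f}.
Proof.
move=> cf t /andP[t0 tb].
have t2 : 0 < t / 2 < b by apply/andP; split; [rewrite divr_gt0|]; lra.
have /andP[_ t2b] := t2.
apply: (within_continuous_continuous t2b (cf _ t2)).
by rewrite in_itv /= tb andbT; lra.
Qed.

Section eigenvalue_zero.
Local Open Scope complex_scope.
Variables (R : realType) (l : nat) (Z h b s : R).
Hypotheses (Z_gt0 : 0 < Z) (h_gt0 : 0 < h) (b_gt0 : 0 < b) (s_gt0 : 0 < s).

Let c := Z / h ^+ 2.
Let V := coulomb_pot l c s.
Let E := - (Z ^+ 2 * s ^+ 2 / (4 * h ^+ 2)).
Let c_gt0 : 0 < c. Proof. by rewrite divr_gt0 // exprn_gt0. Qed.

Lemma coulomb_pot_continuous (t : R) : 0 < t -> {for t, continuous V}.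
Proof.
move=> t0; have tn : t != 0 by rewrite gt_eqF.
have tn2 : t ^+ 2 != 0 by rewrite expf_neq0.
have D := derive_add (derive_sub
  (derive_scale (l * l.+1)%:R 
    (derive_inv (f := fun t => t ^+ 2) tn2 (derive_pow 2 (derive_ident t))))
  (derive_scale c (derive_inv (f := fun t => t) tn (derive_ident t))))
  (derive_const t ((c * s) ^+ 2 / 4)).
have [H _] := D.
exact/differentiable_continuous/derivable1_diffP.
Qed.

(** w stands for the real or imaginary part of D_y u, which up to the sign sg is
    the derivative g of r. *)
Lemma ac_solves (sg : R) (r g w k : R -> R) :
  sg != 0 -> ac_deriv b r g -> ac_deriv b w k ->
  (forall y, w y = sg * g y) ->
  {ae lebesgue_measure, forall y : R, 0 < y < b -> k y = sg * (V y * r y)} ->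
  solves b V r g.
Proof.
move=> sg0 rg wk wg kV.
have gE : g = (fun y => sg^-1 * w y) by apply/funext => y; rewrite wg mulKf.
have interior := @continuous_interior R b.
have cw := ac_continuous wk.
have cg : forall y : R, 0 < y < b -> {within `[y, b], continuous g}.
  move=> y yb; rewrite gE => t; apply: cvgM; [exact: cvg_cst|exact: (cw y yb)].
have cr := ac_continuous rg.
have crV t : 0 < t < b -> {for t, continuous (fun y => sg * (V y * r y))}.
  move=> tb; apply: cvgM; first exact: cvg_cst.
  apply: cvgM; last exact: (interior r).
  by apply: coulomb_pot_continuous; case/andP: tb.
split => //.
- move=> y yb; apply: (ac_is_derive rg) => //; last exact: interior.
  by apply: aeW.
- move=> y yb; have H := ac_is_derive wk kV crV yb.
  rewrite gE; apply: (is_derive_eq (derive_scale sg^-1 H)).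
  by rewrite mulKf.
Qed.

(** For l = 0 the boundary condition at 0, for l > 0 square integrability, rules
    out the singular growth. *)
Lemma real_dirichlet_eq0 (sg : R) (r g w k : R -> R) :
  regular_sol l c s b != 0 ->
  sg != 0 -> ac_deriv b r g -> ac_deriv b w k ->
  (forall y, w y = sg * g y) ->
  {ae lebesgue_measure, forall y : R, 0 < y < b -> k y = sg * (V y * r y)} ->
  r b = 0 -> (r \_ `]0, b[ : R -> R) \in Lfun lebesgue_measure 2%:E ->
  (l = 0%N -> r y @[y --> 0^'+] --> (0 : R)) ->
  forall y, 0 < y < b -> r y = 0.
Proof.
move=> phib sg0 rg wk wg kV rb rL r0.
have sr := ac_solves sg0 rg wk wg kV.
apply: (dirichlet_regular c_gt0 s_gt0 b_gt0 sr rb phib) => c0 y1 c00 y10 H.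
have [l0|l0] := posnP l; last exact: (L2_not_singular b_gt0 l0 rL c00 y10 H).
have /cvgrPdist_lt /(_ _ c00) := r0 l0.
move=> Hn.
near (0 : R)^'+ => y.
have y0 : 0 < y by [].
have yy1 : y < y1 by near: y; exact: nbhs_right_lt.
have := H y; rewrite y0 yy1 l0 expr0 mulr1 => /(_ isT).
have : `|0 - r y| < c0 by near: y.
by rewrite sub0r normrN ltNge => /negP.
Unshelve. all: by end_near. Qed.

(** Real and imaginary parts of an eigenfunction are separately solutions; the
    factor - i of D_y exchanges them, which explains the two signs. *)
Lemma eigenvalue_kummer0 : coulomb_eigenvalue l Z h b E -> kummer l s (c * b) = 0.
Proof.
move=> [u [[uL _ ub u0 [u1 [u2 [[g1 [[r1 i1] u1E]] [g2 [[r2 i2] u2E]] eq]]]] unz]].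
have [+ _] := regular_sol_eq0 l s c_gt0 b_gt0; apply; apply/eqP/negPn/negP => phib.
apply: unz; apply: aeW => y yb.
have hn : h != 0 by rewrite gt_eqF.
have VE t : V t = (l * l.+1)%:R / t ^+ 2 - Z / h ^+ 2 / t - E / h ^+ 2.
  by rewrite /V /coulomb_pot /E /c; congr (_ + _); field.
have reu : complex.Re (u y) = 0.
  apply: (real_dirichlet_eq0 (sg := -1) phib _ r1 i2) yb => //.
  - move=> t; rewrite u1E; case: (g1 t) => a d /=; ring.
  - apply: (@filterS _ _ (ae_filter_ringOfSetsType lebesgue_measure) _ _ _ eq) => t Ht tb.
    have {}Ht := Ht tb; have t0 : t != 0 by rewrite gt_eqF //; case/andP: tb.
    move: Ht; rewrite u2E VE; case: (u t) (g2 t) => a d [p q] /=.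
    move=> /(congr1 (@complex.Re R)) /=.
    set L := (l * l.+1)%:R => Ht.
    have -> : q = (E * a - 0 * d + 0 * (- 0 * q + -1 * p)
      - (h ^+ 2 * L / t ^+ 2 * a - 0 * d) + (Z / t * a - 0 * d)) / h ^+ 2.
      by rewrite Ht; field; rewrite hn t0.
    by move: (E) => e; field; rewrite hn t0.
  - by rewrite ub.
  - by case: uL.
  - by move=> /u0[].
have imu : complex.Im (u y) = 0.
  apply: (real_dirichlet_eq0 (sg := 1) phib _ i1 r2) yb => //.
  - move=> t; rewrite u1E; case: (g1 t) => a d /=; ring.
  - apply: (@filterS _ _ (ae_filter_ringOfSetsType lebesgue_measure) _ _ _ eq) => t Ht tb.
    have {}Ht := Ht tb; have t0 : t != 0 by rewrite gt_eqF //; case/andP: tb.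
    move: Ht; rewrite u2E VE; case: (u t) (g2 t) => a d [p q] /=.
    move=> /(congr1 (@complex.Im R)) /=.
    set L := (l * l.+1)%:R => Ht.
    have -> : p = (E * d + 0 * a - h ^+ 2 * (- 0 * q) - 0 * (- 0 * p - -1 * q)
      - (h ^+ 2 * L / t ^+ 2 * d + 0 * a) + (Z / t * d + 0 * a)) / (- h ^+ 2).
      by rewrite Ht; field; rewrite hn t0.
    by move: (E) => e; field; rewrite hn t0.
  - by rewrite ub.
  - by case: uL.
  - by move=> /u0[].
by move: reu imu; case: (u y) => a d /= -> ->.
Qed.

Lemma kummer0_eigenvalue : kummer l s (c * b) = 0 -> coulomb_eigenvalue l Z h b E.
Proof.
move=> kb.
pose phi := regular_sol l c s; pose psi := regular_der l c s.
have phib : phi b = 0 by apply/(regular_sol_eq0 l s c_gt0 b_gt0).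
have hn : h != 0 by rewrite gt_eqF.
have cphi : continuous phi := continuous_regular_sol s_gt0.
have ac0 : ac_deriv b (fun=> 0) (fun=> 0).
  by apply: C1_ac_deriv => y y0; exact: cvg_cst.
have ac1 : ac_deriv b phi psi.
  apply: C1_ac_deriv => y y0; first exact: is_derive_regular_sol.
  have [H _] := is_derive_regular_der l c_gt0 s_gt0 y0.
  exact/differentiable_continuous/derivable1_diffP.
have cVphi t : 0 < t -> {for t, continuous (fun y => - (V y * phi y))}.
  move=> t0; apply: cvgN; apply: cvgM; first exact: coulomb_pot_continuous.
  exact: cphi.
have ac2 : ac_deriv b (fun y => - psi y) (fun y => - (V y * phi y)).
  apply: C1_ac_deriv => y y0; last exact: cVphi.
  exact: (is_deriveN (is_derive_regular_der l c_gt0 s_gt0 y0)).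
exists (fun y => (phi y)%:C); split.
  split.
  - split=> /=; first exact: L2_continuous.
    by apply: L2_continuous => t; exact: cvg_cst.
  - split=> /=.
      rewrite (_ : (fun y => E * phi y - 0 * 0) = (fun y => E * phi y)); last first.
        by apply/funext => y; rewrite mul0r subr0.
      by apply: L2_continuous => t; apply: cvgM; [exact: cvg_cst|exact: cphi].
    rewrite (_ : (fun y => E * 0 + 0 * phi y) = (fun=> 0)); last first.
      by apply/funext => y; rewrite mulr0 mul0r addr0.
    by apply: L2_continuous => t; exact: cvg_cst.
  - by rewrite phib.
  - move=> _; split=> /=; last exact: cvg_cst.
    by apply: cvg_at_right_filter; rewrite -[X in _ --> X](regular_sol0 l c s); exact: cphi.
  exists (fun y => - 'i%C * (psi y)%:C), (fun y => - 'i%C * (- 'i%C * (V y * phi y)%:C)).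
  split.
  - exists (fun y => (psi y)%:C); split => //.
  - exists (fun y => - 'i%C * (V y * phi y)%:C); split => //.
    split => /=.
      rewrite (_ : (fun y => - 0 * psi y - -1 * 0) = (fun=> 0)); last first.
        by apply/funext => y; ring.
      rewrite (_ : (fun y => _) = (fun=> 0)) //.
      by apply/funext => y; ring.
    rewrite (_ : (fun y => - 0 * 0 + -1 * psi y) = (fun y => - psi y)); last first.
      by apply/funext => y; ring.
    rewrite (_ : (fun y => - 0 * 0 + _) = (fun y => - (V y * phi y))) //.
    by apply/funext => y; ring.
  - apply: aeW => y /andP[y0 yb]; have yn : y != 0 by rewrite gt_eqF.
    apply/eqP; rewrite eq_complex /=; apply/andP; split; apply/eqP; last by ring.
    rewrite /V /coulomb_pot /c /E; move: (phi y) => p; move: ((l * l.+1)%:R) => L.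
    by field; rewrite hn yn.
(* the eigenfunction is positive near 0, hence not null a.e. *)
have [a [k [K [a0 k0 pB]]]] := regular_sol_near0 l c_gt0 s_gt0.
pose d := Num.min a b.
have d0 : 0 < d by rewrite lt_min a0.
move=> unz.
have N1 : lebesgue_measure.-negligible (`]0, d[%classic : set R).
  apply: negligibleS unz => y /=; rewrite in_itv /= => /andP[y0].
  rewrite lt_min => /andP[ya yb] H.
  have := H (introT andP (conj y0 yb)).
  move=> /(congr1 (@complex.Re R)) /= py0.
  have /andP[+ _] := pB y (introT andP (conj y0 ya)).
  by rewrite leNgt -/phi py0 mulr_gt0 ?exprn_gt0.
have : lebesgue_measure (`]0, d[%classic : set R) = 0%E.
  by apply: measure_negligible N1; exact: measurable_itv.
rewrite lebesgue_measure_itv /= lte_fin d0 => /eqP.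
by rewrite -EFinD eqe subr0 gt_eqF.
Qed.

End eigenvalue_zero.

(** * Counting the levels and expanding the energy *)

(** The thresholds of [kummer_zero] for the finitely many N <= M are replaced by
    their sum, which bounds each of them as they are nonnegative. *)
Lemma kummer_levels (R : realType) (l M : nat) :
  exists2 X : R, 1 <= X & exists2 C : R, 0 <= C &
  forall x : R, X <= x -> exists s : nat -> R,
    [/\ forall N, (N <= M)%N ->
          2 < (2 * (l + N).+1%:R + 1) * s N /\ (l + N).+1%:R * s N < 1,
        forall N, (N <= M)%N -> kummer l (s N) x = 0,
        forall N s', (N <= M)%N -> 2 <= (2 * (l + N).+1%:R + 1) * s' ->
          (2 * (l + N).+1%:R - 1) * s' <= 2 -> kummer l s' x = 0 -> s' = s N,
        `|(1 - (l + M).+1%:R * s M) / kummer_tau l M x - 1| <= C / x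
      & 1 - (l + M).+1%:R * s M <= C / x].
Proof.
have H N : exists XC : R * R, [/\ 1 <= XC.1, 0 <= XC.2 &
    forall x, XC.1 <= x -> exists s, [/\
    2 < (2 * (l + N).+1%:R + 1) * s /\ (l + N).+1%:R * s < 1,
    kummer l s x = 0,
    (forall s', 2 <= (2 * (l + N).+1%:R + 1) * s' -> (2 * (l + N).+1%:R - 1) * s' <= 2 ->
       kummer l s' x = 0 -> s' = s),
    `|(1 - (l + N).+1%:R * s) / kummer_tau l N x - 1| <= XC.2 / x &
    1 - (l + N).+1%:R * s <= XC.2 / x]].
  by have [X X1 [C C0 HC]] := kummer_zero R l N; exists (X, C).
have [f Hf] := choice H.
have X0 N : 0 <= (f N).1 by have [h _ _] := Hf N; apply: le_trans h.
exists (\sum_(N < M.+1) (f N).1).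
  rewrite big_ord_recr /=; have [h _ _] := Hf M.
  by apply: (le_trans h); rewrite lerDr sumr_ge0.
exists (f M).2; first by have [] := Hf M.
move=> x xX.
have fx N : (N <= M)%N -> (f N).1 <= x.
  move=> NM; apply: le_trans xX.
  by rewrite (bigD1 (Ordinal (NM : N < M.+1)%N)) //= lerDl sumr_ge0.
have /choice[s Hs] : forall N, exists s, (N <= M)%N -> [/\
    2 < (2 * (l + N).+1%:R + 1) * s /\ (l + N).+1%:R * s < 1,
    kummer l s x = 0,
    (forall s', 2 <= (2 * (l + N).+1%:R + 1) * s' -> (2 * (l + N).+1%:R - 1) * s' <= 2 ->
       kummer l s' x = 0 -> s' = s),
    `|(1 - (l + N).+1%:R * s) / kummer_tau l N x - 1| <= (f N).2 / x &
    1 - (l + N).+1%:R * s <= (f N).2 / x].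
  move=> N; have [NM|NM] := leqP N M; last by exists 0.
  by have [_ _ h] := Hf N; have [s hs] := h x (fx N NM); exists s.
exists s; split.
- by move=> N /Hs[].
- by move=> N /Hs[].
- by move=> N s' /Hs[_ _ + _ _]; apply.
- by have [] := Hs M (leqnn M).
- by have [] := Hs M (leqnn M).
Qed.

Section counting.
Variables (R : realType) (l M : nat) (Z h b : R).
Hypotheses (Z_gt0 : 0 < Z) (h_gt0 : 0 < h) (b_gt0 : 0 < b).

Definition energy (s : R) : R := - (Z ^+ 2 * s ^+ 2 / (4 * h ^+ 2)).

Lemma energy_lt (s t : R) : 0 <= s -> 0 <= t -> (energy s < energy t) = (t < s).
Proof.
move=> s0 t0; have h0 : 0 < 4 * h ^+ 2 by rewrite mulr_gt0 ?exprn_gt0.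
have Z0 : 0 < Z ^+ 2 by rewrite exprn_gt0.
by rewrite /energy ltrN2 ltr_pM2r ?invr_gt0 // ltr_pM2l // ltr_pXn2r.
Qed.

Lemma energy_surj (E : R) : E < 0 -> exists2 s, 0 < s & E = energy s.
Proof.
move=> E0; exists (2 * h * Num.sqrt (- E) / Z).
  by rewrite divr_gt0 // !mulr_gt0 // sqrtr_gt0 oppr_gt0.
rewrite /energy expr_div_n !exprMn sqr_sqrtr ?oppr_ge0 ?(ltW E0) //.
by field; rewrite !gt_eqF.
Qed.

Variable s : nat -> R.
Let x := Z / h ^+ 2 * b.
Hypothesis s_itv : forall N, (N <= M)%N ->
  2 < (2 * (l + N).+1%:R + 1) * s N /\ (l + N).+1%:R * s N < 1.
Hypothesis s_zero : forall N, (N <= M)%N -> kummer l (s N) x = 0.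
Hypothesis s_uniq : forall N s', (N <= M)%N -> 2 <= (2 * (l + N).+1%:R + 1) * s' ->
  (2 * (l + N).+1%:R - 1) * s' <= 2 -> kummer l s' x = 0 -> s' = s N.

Lemma level_gt0 N : (N <= M)%N -> 0 < s N.
Proof.
move=> /s_itv[+ _]; rewrite -(pmulr_rgt0 _ (_ : 0 < 2 * (l + N).+1%:R + 1)).
  by apply: lt_trans.
by rewrite addr_gt0 // mulr_gt0 // ltr0n.
Qed.

Lemma level_decr N K : (N < K)%N -> (K <= M)%N -> s K < s N.
Proof.
move=> NK KM; have [h1 _] := s_itv (leq_trans (ltnW NK) KM); have [_ h2] := s_itv KM.
have sK := level_gt0 KM.
have mNK : (l + N).+1%:R + 1 <= (l + K).+1%:R :> R by rewrite natr1 ler_nat ltnS ltn_add2l.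
have m0 : 0 < 2 * (l + N).+1%:R + 1 :> R by rewrite addr_gt0 // mulr_gt0 // ltr0n.
rewrite -(ltr_pM2l m0); apply: lt_trans h1.
have : ((l + N).+1%:R + 1) * s K <= (l + K).+1%:R * s K by rewrite ler_pM2r.
by move: ((l + N).+1%:R) ((l + K).+1%:R) (s K) h2 sK {mNK m0} => p q t; lra.
Qed.

(** An eigenvalue below the M-th level corresponds to a zero t > s M, and
    t < 1/(l+1) since Kummer's function is positive beyond.  The least N with
    2 <= (2 (l+N+1) + 1) t is then at most M, and by minimality t lies in the
    window of index N, whose only zero is s N. *)
Lemma lower_levels :
  [set E' : R | coulomb_eigenvalue l Z h b E' /\ E' < energy (s M)]
  = [set energy (s N) | N in `I_M].
Proof.
apply/seteqP; split => [E' /= [eigE ltE]|_ /= [N NM <-]]; last first.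
  have NM' := ltnW NM; split.
    by apply: kummer0_eigenvalue => //; [exact: level_gt0|exact: s_zero].
  by rewrite energy_lt ?level_decr // ltW // level_gt0.
have sM := level_gt0 (leqnn M).
have E'0 : E' < 0.
  apply: (lt_le_trans ltE); rewrite /energy oppr_le0.
  by rewrite divr_ge0 // mulr_ge0 // ?sqr_ge0.
have [t t0 tE] := energy_surj E'0.
have tz : kummer l t x = 0 by apply: eigenvalue_kummer0 => //; rewrite tE in eigE.
have tM : s M < t by rewrite -energy_lt ?(ltW sM) ?(ltW t0) // -tE.
have x0 : 0 <= x by rewrite mulr_ge0 ?divr_ge0 ?sqr_ge0 // ltW.
have tl : (l + 1)%:R * t < 1.
  by rewrite ltNge; apply/negP => /(kummer_gt0 x0); rewrite tz ltxx.
pose P N := 2 <= (2 * (l + N).+1%:R + 1) * t.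
have PM : P M.
  have [h1 _] := s_itv (leqnn M); apply: ltW; apply: (lt_trans h1).
  by rewrite ltr_pM2l // addr_gt0 // mulr_gt0 // ltr0n.
have exP : exists N, P N by exists M.
case: (ex_minnP exP) => N PN minN.
have NM : (N <= M)%N := minN M PM.
have up : (2 * (l + N).+1%:R - 1) * t <= 2.
  case: N {PN NM} minN => [|N] minN.
    rewrite addn0 -[l.+1]addn1; move: ((l + 1)%:R) tl t0 => p; lra.
  have : ~~ P N by apply/negP => /minN; rewrite ltnn.
  rewrite /P -ltNge addnS -[(l + N).+2%:R]natr1; move: ((l + N).+1%:R) => p; lra.
have tN := s_uniq NM PN up tz.
exists N; last by rewrite tE tN.
rewrite /= ltn_neqAle NM andbT; apply/eqP => NME.
by move: tM; rewrite tN NME ltxx.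
Qed.

Lemma nth_level : coulomb_nth_eigenvalue l Z h b (l + M).+1 (energy (s M)).
Proof.
have sM := level_gt0 (leqnn M); split.
- by rewrite ltnS leq_addr.
- by rewrite /energy oppr_lt0 divr_gt0 ?mulr_gt0 ?exprn_gt0.
- by apply: kummer0_eigenvalue => //; exact: s_zero.
rewrite lower_levels subSS addKn.
apply: inj_card_eq => N K; rewrite !inE /= => NM KM.
have [NK|NK|//] := ltngtP N K.
  have := level_decr NK (ltnW KM).
  by rewrite -energy_lt ?ltW ?level_gt0 1?ltnW // => /[swap] ->; rewrite ltxx.
have := level_decr NK (ltnW NM).
by rewrite -energy_lt ?ltW ?level_gt0 1?ltnW // => /[swap] ->; rewrite ltxx.
Qed.

End counting.

(** With T = 1 - n s, the shift is Z^2 / (2 n^2 h^2) T (1 - T/2), and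
    Z^2 / (2 n^2 h^2) times [kummer_tau] is the announced leading term. *)
Lemma energy_expansion (R : realType) (l M : nat) (Z h b s C : R) :
  let n := (l + M).+1 in let x := Z / h ^+ 2 * b in
  0 < Z -> 0 < h -> 0 < b -> 1 <= x -> 0 <= C -> n%:R * s < 1 ->
  `|(1 - n%:R * s) / kummer_tau l M x - 1| <= C / x -> 1 - n%:R * s <= C / x ->
  exists theta : R, `|theta| <= (2 + C) * C / Z * (h ^+ 2 * b^-1) /\
    energy Z h s = - (Z ^+ 2 / (4%:R * n%:R ^+ 2 * h ^+ 2))
            + (2%:R ^+ (2 * n + 1)%N * h ^- (4 * n + 2)%N * b ^+ (2 * n)%N)
              / (n%:R ^+ (2 * n + 3)%N
                 * (M`!)%:R * ((n + l)%N`!)%:R)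
              * (2%:R / Z) ^- (2 * n + 2)%N
              * expR (- (Z * b) / (n%:R * h ^+ 2))
              * (1 + theta).
Proof.
move=> n x Z0 h0 b0 x1 C0 ns r1 t1.
have n0 : n%:R != 0 :> R by rewrite pnatr_eq0.
have x0 : 0 < x by apply: lt_le_trans x1.
have F k : k`!%:R != 0 :> R by rewrite pnatr_eq0 -lt0n fact_gt0.
have tau0 : 0 < kummer_tau l M x.
  rewrite /kummer_tau !mulr_gt0 ?exprn_gt0 ?expR_gt0 ?divr_gt0 ?invr_gt0 ?ltr0n //.
move: (F (n + l)%N) (F M) => Fnl FM.
pose T := 1 - n%:R * s; pose r := T / kummer_tau l M x.
have T0 : 0 < T by rewrite subr_gt0.
have r0 : 0 < r by rewrite divr_gt0.
exists (r * (1 - T / 2) - 1); split.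
  have -> : (2 + C) * C / Z * (h ^+ 2 * b^-1) = (2 + C) * (C / x).
    by rewrite /x; field; rewrite !gt_eqF.
  have Cx : C / x <= C by rewrite ler_pdivrMr // ler_peMr.
  have -> : r * (1 - T / 2) - 1 = (r - 1) - r * T / 2 by ring.
  rewrite -/T -/r in r1; apply: (le_trans (ler_normB _ _)).
  have r2 : r <= 1 + C.
    by move: r1; rewrite ler_norml => /andP[_ h1]; move: (C / x) h1 Cx => q; clear; lra.
  have p0 : 0 <= r * T / 2 by rewrite divr_ge0 // mulr_ge0 // ltW.
  rewrite (ger0_norm p0).
  have rT : r * T <= (1 + C) * (C / x) by apply: ler_pM => //; exact: ltW.
  have Cx0 : 0 <= C * (C / x) by rewrite mulr_ge0 // divr_ge0 // ltW.
  have Cx1 : 0 <= C / x by rewrite divr_ge0 // ltW.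
  by move: (C / x) r1 rT Cx0 Cx1 => q; clear; lra.
have sE : s = (1 - T) / n%:R by rewrite /T; field.
have -> : energy Z h s = - (Z ^+ 2 / (4%:R * n%:R ^+ 2 * h ^+ 2))
    + Z ^+ 2 / (2 * n%:R ^+ 2 * h ^+ 2) * (kummer_tau l M x * (r * (1 - T / 2))).
  rewrite /energy sE /r; move: (kummer_tau l M x) tau0 => t t0.
  by field; rewrite n0 !gt_eqF.
congr (_ + _).
rewrite [1 + (_ - 1)]addrC subrK [LHS]mulrA; congr (_ * _).
have -> : expR (- (Z * b) / (n%:R * h ^+ 2)) = expR (- (x / n%:R)).
  by congr expR; rewrite /x; field; rewrite n0 gt_eqF.
rewrite /kummer_tau /head_lead -/n; move: (expR _) => e.
rewrite (_ : (4 * n + 2 = 2 * (2 * n) + 2)%N); last by rewrite mulnA.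
rewrite /x !exprD !expr_div_n !exprMn !exprVn -exprM.
have e1 (y : R) : y ^+ 3 = y ^+ 2 * y by rewrite exprSr.
have hk : h ^+ (2 * (2 * n)) != 0 by rewrite expf_neq0 // gt_eqF.
have nk : n%:R ^+ (2 * n) != 0 :> R by rewrite expf_neq0.
have Zk : Z ^+ (2 * n) != 0 by rewrite expf_neq0 // gt_eqF.
have tk : 2 ^+ (2 * n) != 0 :> R by rewrite expf_neq0.
move: (h ^+ (2 * (2 * n))) (n%:R ^+ (2 * n)) (Z ^+ (2 * n)) (2 ^+ (2 * n)) (b ^+ (2 * n))
  hk nk Zk tk => hk nk Zk tk bk hk0 nk0 Zk0 tk0.
by field; rewrite ?hk0 ?nk0 ?Zk0 ?tk0 ?Fnl ?FM ?n0 !gt_eqF.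
Qed.

Theorem corollary1p3 (R : realType) (l : nat) (Z : R) (Z_gt0 : 0 < Z)
    (n : nat) (l_lt_n : (l < n)%N) :
  exists eps C : R, 0 < eps /\
    forall h b : R, 0 < h -> 0 < b -> b^-1 * h ^+ 2 < eps ->
    exists E : R,
      coulomb_nth_eigenvalue l Z h b n E /\
      exists theta : R,
        `|theta| <= C * (h ^+ 2 * b^-1) /\
        E = - (Z ^+ 2 / (4%:R * n%:R ^+ 2 * h ^+ 2))
            + (2%:R ^+ (2 * n + 1)%N * h ^- (4 * n + 2)%N * b ^+ (2 * n)%N)
              / (n%:R ^+ (2 * n + 3)%N
                 * ((n - l - 1)%N`!)%:R * ((n + l)%N`!)%:R)
              * (2%:R / Z) ^- (2 * n + 2)%N
              * expR (- (Z * b) / (n%:R * h ^+ 2))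
              * (1 + theta).
Proof.
have [M nE] : exists M, n = (l + M).+1 by exists (n - l.+1)%N; rewrite -addSn subnKC.
have [X X1 [C C0 H]] := kummer_levels R l M.
have X0 : 0 < X by apply: lt_le_trans X1.
exists (Z / X), ((2 + C) * C / Z); split; first exact: divr_gt0.
move=> h b h0 b0 small; subst n.
have xX : X <= Z / h ^+ 2 * b.
  move: small; rewrite ltr_pdivlMr // => /ltW small.
  rewrite mulrAC ler_pdivlMr ?exprn_gt0 // -ler_pdivrMr //.
  by apply: le_trans small; rewrite le_eqVlt; apply/orP; left; apply/eqP; ring.
have [s [s_itv s_zero s_uniq r1 t1]] := H _ xX.
exists (energy Z h (s M)); split; first exact: (nth_level Z_gt0 h0 b0 s_itv s_zero s_uniq).
have [_ ns] := s_itv M (leqnn M).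
have -> : ((l + M).+1 - l - 1 = M)%N by rewrite subSn ?leq_addr // subn1 addKn.
exact: (energy_expansion Z_gt0 h0 b0 (le_trans X1 xX) C0 ns r1 t1).
Qed.
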